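(* Let $\mu$ be an invariant probability measure with respect to a $C^1$ map $f:M\to M$ such that $\inf_{x\in M}\|Df(x)\|>0$ and $\chi(x)<0$ for $\mu$-a.e. $x\in M$. Then $\mu$ decomposes as $\mu=\tilde\mu+\sum_{i\ge1}\mu_i$, where each $\mu_i$ is a (positive multiple of a) Dirac mass equidistributed on a periodic attracting orbit of $f$ (a sink), the sum is over at most countably many such orbits, and $\tilde\mu$ (which might be the null measure) satisfies $A_1^-(x)\ge0$ for $\tilde\mu$-a.e. $x\in M$. In addition, if $\mu$ is $f$-ergodic, then $\mu$ is concentrated on the orbit of a periodic attractor (sink).
   Context: $M$ is a connected compact $d$-dimensional manifold, $d\ge 2$, endowed with a Riemannian metric inducing a norm $\|\cdot\|$ on the tangent bundle (and operator norms) and a distance $\operatorname{dist}$ on $M$. Here $$\chi(x)=\lim_{n\to+\infty}\frac1n\ln\|Df^n(x)\|$$ (which exists in $[-\infty,\infty)$ for $\mu$-a.e. $x$) and $$A^-_1(x)=\liminf_{n\to+\infty}\frac1n\sum_{j=0}^{n-1}\ln\|Df(f^{j}x)\|.$$ A point $p$ belongs to a periodic orbit (with period $\tau$) if $f^\tau p=p$ for some $\tau\in\mathbb{Z}^+$. The periodic orbit $\mathcal{O}_f(p)=\{p,fp,\dots,f^{\tau-1}p\}$ is attracting (a sink) if, for some such $\tau$ (not required to be minimal), there is a neighborhood $V_p$ of $p$ such that $f^\tau|_{V_p}:V_p\to V_p$ is a contraction (there is $0<\lambda<1$ with $\operatorname{dist}(f^\tau q,f^\tau r)<\lambda\operatorname{dist}(q,r)$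 for all distinct $q,r\in V_p$; equivalently $\|Df^\tau(p)\|<\lambda$ for some $\lambda\in(0,1)$). The Dirac mass equidistributed on $\mathcal{O}_f(p)$ is $\tau^{-1}\sum_{j=0}^{\tau-1}\delta_{f^jp}$. *)

(* Defs.v *)
From HB Require Import structures.
From mathcomp Require Import all_boot all_order all_algebra.
From mathcomp Require Import all_classical all_reals all_analysis.

Set Implicit Arguments.
Unset Strict Implicit.
Unset Printing Implicit Defensive.

Import Order.TTheory GRing.Theory Num.Theory.
Import numFieldNormedType.Exports.

Local Open Scope classical_set_scope.
Local Open Scope ring_scope.

(* Only used for open U, where it agrees with the textbook notion: in finite
   dimension the continuity of each directional derivative x |-> 'd f x v
   amounts to the continuity of x |-> 'd f x for the operator norm. *)
Fixpoint Ck_on (R : realType) (V W : normedModType R) (k : nat) (U : set V)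
    (f : V -> W) : Prop :=
  match k with
  | 0%N => forall x, U x -> {for x, continuous f}
  | k'.+1 => (forall x, U x -> differentiable f x) /\
             (forall v : V, Ck_on k' U (fun x => 'd f x v))
  end.

Definition smooth_on (R : realType) (V W : normedModType R) (U : set V)
    (f : V -> W) : Prop :=
  forall k, Ck_on k U f.

(* A C^oo atlas of dimension d: on dom i, coord i is a homeomorphism onto an
   open subset of R^d, with inverse param i. The values of coord i outside
   dom i, and of param i outside coord i @` dom i, are irrelevant. The function
   chart_at selects a chart around each point; nothing below depends on the
   selection. *)
Record smooth_manifold (R : realType) (d : nat) (M : topologicalType) :=
  SmoothManifold {
    chart : Type;
    dom : chart -> set M;
    coord : chart -> M -> 'rV[R]_d;
    param : chart -> 'rV[R]_d -> M;
    chart_at : M -> chart;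
    dom_chart_at : forall x, dom (chart_at x) x;
    dom_open : forall i, open (dom i);
    codom_open : forall i, open (coord i @` dom i);
    coord_continuous : forall i x, dom i x -> {for x, continuous (coord i)};
    param_continuous : forall i y, (coord i @` dom i) y ->
      {for y, continuous (param i)};
    coordK : forall i x, dom i x -> param i (coord i x) = x;
    transition_smooth : forall i j,
      smooth_on (coord i @` (dom i `&` dom j)) (coord j \o param i)
  }.

Arguments dom {R d M s}.
Arguments coord {R d M s}.
Arguments param {R d M s}.
Arguments chart_at {R d M}.

(* metric i y is the Gram matrix of the coordinate frame of the chart i at the
   point of coordinates y; metric_compat is the transformation law of
   covariant 2-tensors. *)
Record riemannian_metric (R : realType) (d : nat) (M : topologicalType)
    (X : smooth_manifold R d M) := RiemannianMetric {
  metric : chart X -> 'rV[R]_d -> 'M[R]_d;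
  metric_smooth : forall i, smooth_on (coord i @` dom i) (metric i);
  metric_sym : forall i y, (coord i @` dom i) y -> (metric i y)^T = metric i y;
  metric_pos : forall i y, (coord i @` dom i) y ->
    forall v : 'rV[R]_d, v != 0 -> 0 < (v *m metric i y *m v^T) 0 0;
  metric_compat : forall i j x, dom i x -> dom j x ->
    forall v w : 'rV[R]_d,
      let T := 'd (coord j \o param i) (coord i x) in
      (v *m metric i (coord i x) *m w^T) 0 0 =
      (T v *m metric j (coord j x) *m (T w)^T) 0 0
}.

(* The tangent space at x is identified with R^d through the chart i. *)
Definition tangent_norm (R : realType) (d : nat) (M : topologicalType)
    (X : smooth_manifold R d M) (g : riemannian_metric X)
    (i : chart X) (x : M) (v : 'rV[R]_d) : R :=
  Num.sqrt ((v *m metric g i (coord i x) *m v^T) 0 0).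

Definition tangent_map (R : realType) (d : nat) (M : topologicalType)
    (X : smooth_manifold R d M) (f : M -> M) (x : M) : 'rV[R]_d -> 'rV[R]_d :=
  'd (coord (chart_at X (f x)) \o f \o param (chart_at X x))
     (coord (chart_at X x) x).

Definition opnorm_tangent (R : realType) (d : nat) (M : topologicalType)
    (X : smooth_manifold R d M) (g : riemannian_metric X)
    (f : M -> M) (x : M) : R :=
  sup [set tangent_norm g (chart_at X (f x)) (f x) (tangent_map X f x v)
      | v in [set v | tangent_norm g (chart_at X x) x v <= 1]].

Definition C1_map (R : realType) (d : nat) (M : topologicalType)
    (X : smooth_manifold R d M) (f : M -> M) : Prop :=
  continuous f /\
  forall i j : chart X,
    Ck_on 1 (coord i @` (dom i `&` f @^-1` dom j)) (coord j \o f \o param i).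

(* C^1 on a neighborhood of [0, 1]; equivalently, gamma restricted to [0, 1] is
   C^1, with one-sided derivatives at the endpoints. *)
Definition C1_arc (R : realType) (d : nat) (M : topologicalType)
    (X : smooth_manifold R d M) (gamma : R -> M) : Prop :=
  exists O : set R, [/\ open O, `[0, 1] `<=` O,
    (forall t, O t -> {for t, continuous gamma}) &
    forall i : chart X, Ck_on 1 (O `&` gamma @^-1` dom i) (coord i \o gamma)].

Definition speed (R : realType) (d : nat) (M : topologicalType)
    (X : smooth_manifold R d M) (g : riemannian_metric X)
    (gamma : R -> M) (t : R) : R :=
  tangent_norm g (chart_at X (gamma t)) (gamma t)
    (derive1 (coord (chart_at X (gamma t)) \o gamma) t).

Definition arc_length (R : realType) (d : nat) (M : topologicalType)
    (X : smooth_manifold R d M) (g : riemannian_metric X)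
    (gamma : R -> M) : R :=
  Rintegral lebesgue_measure `[0, 1] (speed g gamma).

(* joined g x y l: some piecewise C^1 curve, i.e. a finite concatenation of
   C^1 arcs, goes from x to y and has length l. *)
Inductive joined (R : realType) (d : nat) (M : topologicalType)
    (X : smooth_manifold R d M) (g : riemannian_metric X) :
    M -> M -> R -> Prop :=
  | joined_refl x : joined g x x 0
  | joined_step gamma y l : C1_arc X gamma -> joined g (gamma 1) y l ->
      joined g (gamma 0) y (arc_length g gamma + l).

Definition riemannian_dist (R : realType) (d : nat) (M : topologicalType)
    (X : smooth_manifold R d M) (g : riemannian_metric X) (x y : M) : R :=
  inf [set l | joined g x y l].

Notation borel M := (g_sigma_algebraType (@open M)).

Definition invariant_measure (R : realType) (M : ptopologicalType)
    (f : M -> M) (mu : set (borel M) -> \bar R) : Prop :=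
  forall A : set (borel M), measurable A -> mu (f @^-1` A) = mu A.

Definition ergodic_measure (R : realType) (M : ptopologicalType)
    (f : M -> M) (mu : set (borel M) -> \bar R) : Prop :=
  forall A : set (borel M), measurable A -> f @^-1` A = A ->
    mu A = 0%E \/ mu A = 1%E.

(* lne 0 = -oo, so chi x = -oo when Df^n(x) = 0 for some n and f is C^1. At a
   point where the sequence diverges, chi x is the default value 0 of limn; for
   a C^1 map on a compact manifold, such points form a null set for every
   invariant probability measure. The index n = 0 is irrelevant. *)
Definition chi (R : realType) (d : nat) (M : topologicalType)
    (X : smooth_manifold R d M) (g : riemannian_metric X)
    (f : M -> M) (x : M) : \bar R :=
  limn (fun n => (n%:R^-1)%:E * lne (opnorm_tangent g (iter n f) x)%:E)%E.

Definition A1_minus (R : realType) (d : nat) (M : topologicalType)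
    (X : smooth_manifold R d M) (g : riemannian_metric X)
    (f : M -> M) (x : M) : \bar R :=
  limn_einf (fun n => (n%:R^-1)%:E *
    \sum_(0 <= j < n) lne (opnorm_tangent g f (iter j f x))%:E)%E.

Definition orbit_set (T : Type) (f : T -> T) (p : T) : set T :=
  range (fun n => iter n f p).

Definition sink (R : realType) (d : nat) (M : topologicalType)
    (X : smooth_manifold R d M) (g : riemannian_metric X)
    (f : M -> M) (p : M) : Prop :=
  exists2 tau : nat, (0 < tau)%N /\ iter tau f p = p &
  exists2 V : set M, nbhs p V /\ (forall q, V q -> V (iter tau f q)) &
  exists2 lambda : R, 0 < lambda < 1 &
    forall q r, V q -> V r -> q <> r ->
      riemannian_dist g (iter tau f q) (iter tau f r) <
      lambda * riemannian_dist g q r.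

(* The result does not depend on the choice of the period tau. *)
Definition equidistributed_dirac (R : realType) (M : ptopologicalType)
    (f : M -> M) (p : M) (tau : nat) (A : set (borel M)) : \bar R :=
  ((tau%:R^-1)%:E * \sum_(j < tau) \d_(iter j f p : borel M) A)%E.

Definition multiple_of_orbit_dirac (R : realType) (M : ptopologicalType)
    (f : M -> M) (p : M) (nu : set (borel M) -> \bar R) : Prop :=
  exists (tau : nat) (c : R), [/\ (0 < tau)%N, iter tau f p = p, 0 < c &
    forall A : set (borel M), measurable A ->
      nu A = (c%:E * equidistributed_dirac R f p tau A)%E].

(* Main.v *)
Require Import Defs.
From HB Require Import structures.
From mathcomp Require Import all_boot all_order all_algebra.
From mathcomp Require Import all_classical all_reals all_analysis.
From mathcomp Require Import measurable_realfun ring lra zify.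

(** The negative exponent forces all the mass of [mu] onto countably
    many sinks, so that the decomposition holds with a zero remainder; the
    ergodic case is then read off the same decomposition.

    The manifold carries a metric [rho], obtained from finitely many truncated
    coordinate maps, that is comparable to the coordinate norms and to the
    Riemannian norms with a constant [C] that is the same at all points
    ([uniform_good_charts]). With it, a point [x] of negative exponent gets
    rates [l < 1] and [K] such that every iterate [f^n] is [K * l ^ n]-Lipschitz
    on some ball around [x] ([opnorm_exp_lipschitz]). The radius depends on
    [n], and the point of the proof is to find one radius that serves all [n].

    Fix [l], and let [B] be the set of the points with this property for some
    [K]. It contains its preimage, so almost every orbit that starts in [B]
    stays in [B]. For [N] large, up to a small measure every point of [B] has a
    ball of a fixed radius [r] on which [f^N] contracts by a factor [a], while
    [f^N] expands by at most [L ^ N] on all balls of radius [r]. Here [L] is a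
    local Lipschitz constant of [f]; since [a] decays like [l ^ N], the number
    [m] of contractions that outweigh one expansion does not depend on [N]
    ([contracting_iterate]). By the maximal inequality, off a small set of
    starting points the proportion of bad times along the [f^N]-orbit is below
    [1 / (2 (m + 1))] from the very first time on, so that the iterates of
    [f^N] contract the whole ball of radius [r] around [x], uniformly in time
    ([contraction_orbit]). Almost every [x] is moreover recurrent, and a
    recurrent point with a contracted ball is periodic: if [G] is an iterate of
    [F = f^N] that brings [x] into its ball, then along times [k] with [F^k x]
    close to [x] the distance from [F^k x] to [F^k (G x)] is small, but it is
    also close to the distance from [x] to [G x]
    ([recurrent_contraction_periodic]).

    So [mu] is carried by periodic points that attract a neighborhood
    exponentially. There are countably many of them, because two that attract
    the same ball coincide ([countable_stable_periodic]). They are sinks for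
    the Riemannian distance, which is comparable to [rho] near every point: a
    high multiple of the period contracts [rho] by more than the product of the
    comparison constants ([contracting_periodic_sink]). Finally an invariant
    measure gives equal masses to the points of a periodic orbit
    ([orbit_decomposition]). *)

(* [coord] and [coord_continuous] are those of the manifold from here on. *)
Import Defs.

Set Implicit Arguments.
Unset Strict Implicit.
Unset Printing Implicit Defensive.

Import Order.TTheory GRing.Theory Num.Theory.
Import numFieldNormedType.Exports.

Local Open Scope classical_set_scope.
Local Open Scope ring_scope.

(** * Invariant measures: maximal inequality and recurrence *)

Section MeasurePreserving.
Context {disp : measure_display} {T : measurableType disp} {R : realType}.
Variables (mu : probability T R) (f : T -> T).
Hypothesis mf : measurable_fun [set: T] f.
Hypothesis mu_f : forall A, measurable A -> mu (f @^-1` A) = mu A.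

Lemma measurable_fun_iter n : measurable_fun [set: T] (iter n f).
Proof.
elim: n => [|n IH]; first exact: measurable_id.
exact: (measurableT_comp mf IH).
Qed.

Lemma measure_iter n A : measurable A -> mu (iter n f @^-1` A) = mu A.
Proof.
move=> mA; elim: n => [//|n IH].
rewrite -IH -(mu_f (A := iter n f @^-1` A)); last first.
  by rewrite -[X in measurable X]setTI; exact: measurable_fun_iter.
by congr (mu _); apply/seteqP; split=> x; rewrite /= -iterSr.
Qed.

Lemma integral_measure_preserving (h : T -> \bar R) :
  measurable_fun [set: T] h -> (forall x, 0 <= h x)%E ->
  (\int[mu]_x h (f x) = \int[mu]_x h x)%E.
Proof.
move=> mh h0.
have -> : (\int[mu]_x h x = \int[pushforward mu f]_x h x)%E.
  apply: eq_measure_integral => A mA _.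
  by rewrite /= /pushforward mu_f.
by rewrite ge0_integral_pushforward// preimage_setT.
Qed.

(** The maximum over [n <= k] of the sums of [h - theta] over the first [n] points
    of the orbit of [x]; the recursion follows the orbit by one step. *)
Fixpoint excess (h : T -> R) (theta : R) (k : nat) (x : T) : R :=
  if k is k'.+1 then Num.max 0 (h x - theta + excess h theta k' (f x)) else 0.

Lemma excess_ge0 h theta k x : 0 <= excess h theta k x.
Proof. by case: k => [|k] //=; rewrite le_max lexx. Qed.

Lemma excess_nondecreasing h theta k x :
  excess h theta k x <= excess h theta k.+1 x.
Proof.
elim: k x => [|k IH] x; first exact: excess_ge0.
rewrite [leLHS]/= [leRHS]/= ge_max !le_max lexx /=.
by rewrite lerD2l IH orbT.
Qed.

Lemma excess_ge_sum h theta k x :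
  \sum_(j < k) (h (iter j f x) - theta) <= excess h theta k x.
Proof.
elim: k x => [|k IH] x; first by rewrite big_ord0.
rewrite big_ord_recl /= le_max; apply/orP; right.
rewrite lerD2l (le_trans _ (IH (f x)))// ler_sum// => j _.
by rewrite -iterSr.
Qed.

Lemma measurable_excess h theta k : measurable_fun [set: T] h ->
  measurable_fun [set: T] (excess h theta k).
Proof.
move=> mh; elim: k => [|k IH]; first exact: measurable_cst.
apply: measurable_maxr; first exact: measurable_cst.
apply: measurable_funD; first by apply: measurable_funB => //; exact: measurable_cst.
exact: (measurableT_comp IH mf).
Qed.

Lemma excess_le h theta k x : 0 <= theta -> (forall x, 0 <= h x <= 1) ->
  excess h theta k x <= k%:R.
Proof.
move=> t0 h01; elim: k x => [//|k IH] x /=.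
rewrite ge_max ler0n /= -natr1 addrC lerD//.
have := h01 x; lra.
Qed.

(** Garsia's argument. On the set [P] where the excess [e] is positive, the
    recursion gives [e <= h - theta + e \o f], and off [P] the excess vanishes.
    So [e + theta * \1_P <= h + e \o f] everywhere, and the integrals of [e] and
    [e \o f] cancel. *)
Lemma measure_excess_gt0 (A : set T) theta k : measurable A -> 0 < theta ->
  (theta%:E * mu [set x | (0 < excess \1_A theta k x)%R] <= mu A)%E.
Proof.
move=> mA t0.
have h01 x : 0 <= (\1_A x : R) <= 1 by rewrite indicE; case: (_ \in _); rewrite ?lexx ler01.
case: k => [|k].
  rewrite [X in mu X](_ : _ = set0) ?measure0 ?mule0//.
  by apply/seteqP; split=> // x /=; rewrite ltxx.
set P := [set x | _]; set e := excess \1_A theta k.+1.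
have e0 x : 0 <= e x by exact: excess_ge0.
have i0 (B : set T) x : 0 <= (\1_B x : R) by rewrite indicE ler0n.
have mi (B : set T) : measurable B -> measurable_fun [set: T] (fun x => (\1_B x : R)%:E).
  by move=> mB; apply/measurable_EFinP; exact: measurable_indic.
have me : measurable_fun [set: T] e by apply: measurable_excess; exact: measurable_indic.
have me' : measurable_fun [set: T] (fun x => (e x)%:E) by exact/measurable_EFinP.
have mP : measurable P.
  have -> : P = [set: T] `&` e @^-1` `]0, +oo[.
    by apply/seteqP; split=> x /=; rewrite in_itv/= andbT; tauto.
  exact: me.
have efin : (\int[mu]_x (e x)%:E)%E \is a fin_num.
  rewrite ge0_fin_numE; last by apply: integral_ge0 => x _; rewrite lee_fin e0.
  have H : (\int[mu]_x (e x)%:E <= \int[mu]_x (cst (k.+1%:R)%:E x))%E.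
    apply: ge0_le_integral => //.
    - by move=> x _; rewrite lee_fin e0.
    - by move=> x _; rewrite lee_fin excess_le// ltW.
  apply: (le_lt_trans H).
  by rewrite integral_cst// [X in (_ * X)%E]probability_setT mule1 ltry.
have mtP : measurable_fun [set: T] (fun x => (theta * \1_P x)%:E).
  by apply/measurable_EFinP; apply: measurable_funM => //; exact: measurable_indic.
have key : (\int[mu]_x ((e x)%:E + (theta * \1_P x)%:E) <=
    \int[mu]_x ((\1_A x)%:E + (e (f x))%:E))%E.
  apply: ge0_le_integral => //.
  - by move=> x _; rewrite -EFinD lee_fin addr_ge0// mulr_ge0// ltW.
  - exact: emeasurable_funD.
  - apply: emeasurable_funD; first exact: mi.
    exact: (measurableT_comp me' mf).
  - move=> x _; rewrite -!EFinD lee_fin.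
    have [h0 _] := andP (h01 x).
    have fx0 := e0 (f x).
    have [Px|nPx] := pselect (P x).
      rewrite indicE mem_set//= mulr1.
      have -> : e x = \1_A x - theta + excess \1_A theta k (f x).
        by rewrite /e/=; apply/max_idPr; move: Px; rewrite /P/= lt_max ltxx/= => /ltW.
      have := excess_nondecreasing \1_A theta k (f x); rewrite -/e; lra.
    rewrite [X in _ * X]indicE memNset//= mulr0 addr0.
    have -> : e x = 0.
      by apply/le_anti; rewrite e0 andbT leNgt; apply/negP.
    exact: addr_ge0.
move: key.
rewrite ge0_integralD//; [|by move=> x _; rewrite lee_fin|by
  move=> x _; rewrite lee_fin mulr_ge0// ltW].
rewrite ge0_integralD//; [|exact: mi|by
  move=> x _; rewrite lee_fin|exact: (measurableT_comp me' mf)].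
rewrite (integral_measure_preserving (h := fun x => (e x)%:E))//.
rewrite addeC leeD2rE// integral_indic// setIT.
under eq_integral do rewrite EFinM.
rewrite ge0_integralZl//; [|exact: mi|by rewrite lee_fin ltW].
by rewrite integral_indic// setIT.
Qed.

(** A weak-type bound that takes the place of the ergodic theorem: it controls the
    frequency of visits to [A] at every time, not only in the limit. *)
Lemma maximal_inequality (A : set T) theta : measurable A -> 0 < theta ->
  exists E, [/\ measurable E, (theta%:E * mu E <= mu A)%E &
   forall x, ~ E x -> forall n, \sum_(j < n) \1_A (iter j f x) <= theta * n%:R].
Proof.
move=> mA t0.
pose P k := [set x | (0 < excess \1_A theta k x)%R].
have mP k : measurable (P k).
  have -> : P k = [set: T] `&` excess \1_A theta k @^-1` `]0, +oo[.
    by apply/seteqP; split=> x /=; rewrite in_itv/= andbT; tauto.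
  by apply: measurable_excess => //; exact: measurable_indic.
have mU : measurable (\bigcup_k P k) by exact: bigcup_measurable.
have ndP : {homo P : n m / (n <= m)%N >-> (n <= m)%O}.
  apply/nondecreasing_seqP => n; apply/subsetPset => x; rewrite /P/= => /lt_le_trans.
  by apply; exact: excess_nondecreasing.
exists (\bigcup_k P k); split => //.
  have H := nondecreasing_cvg_mu (mu := mu) mP mU ndP.
  have H2 : (theta%:E * mu (P n))%E @[n --> \oo] --> (theta%:E * mu (\bigcup_k P k))%E.
    by apply: cvgeZl => //.
  have -> : (theta%:E * mu (\bigcup_k P k))%E = limn (fun n => theta%:E * mu (P n))%E.
    by rewrite (cvg_lim _ H2).
  apply: lime_le; first by apply/cvg_ex; eexists; exact: H2.
  by apply: nearW => n; exact: measure_excess_gt0.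
move=> x nx n.
have : excess \1_A theta n x <= 0.
  by rewrite leNgt; apply/negP => h; apply: nx; exists n.
move=> /(le_trans (excess_ge_sum _ _ n x)).
by rewrite sumrB subr_le0 sumr_const card_ord mulr_natr.
Qed.

(** A point that never returns to [A] after time [K] lies in the union [U] of the
    preimages of [A] but not in the [K]-th preimage of [U]. These two sets are
    nested and have the same measure. *)
Lemma poincare_recurrence (A : set T) : measurable A ->
  mu.-negligible (A `\` [set x | forall K, exists2 n, (K <= n)%N & A (iter n f x)]).
Proof.
move=> mA.
have mi n B : measurable B -> measurable (iter n f @^-1` B).
  by move=> mB; rewrite -[X in measurable X]setTI; exact: measurable_fun_iter.
pose U := \bigcup_n (iter n f @^-1` A).
have mU : measurable U by apply: bigcup_measurable => n _; exact: mi.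
have subK K : iter K f @^-1` U `<=` U.
  by move=> x [n _ An]; exists (n + K)%N => //; rewrite /= iterD.
apply: (@negligibleS _ _ _ mu (\bigcup_K (U `\` iter K f @^-1` U))); last first.
  apply: negligible_bigcup => K; exists (U `\` iter K f @^-1` U); split => //.
    by apply: measurableD => //; exact: mi.
  rewrite measureD//; [|exact: mi|by rewrite -ge0_fin_numE// fin_num_measure].
  by rewrite setIidr// [X in (_ - X)%E](measure_iter K mU) subee// fin_num_measure.
move=> x [Ax /= /existsNP[K nK]].
exists K => //; split; first by exists 0%N.
move=> [n _ An]; apply: nK; exists (n + K)%N; first exact: leq_addl.
by rewrite iterD.
Qed.

End MeasurePreserving.

(** * Metrics of the topology and local Lipschitz constants *)

Lemma iter_period {T : Type} (f : T -> T) n k x : iter n f x = x -> iter (k * n) f x = x.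
Proof. by move=> nx; rewrite iterM; elim: k => [//|k IH]; rewrite iterS IH. Qed.

Lemma continuous_iter {T : topologicalType} {f : T -> T} (cf : continuous f) n :
  continuous (iter n f).
Proof.
elim: n => [|n IH] x; first exact: cvg_id.
by apply: (@continuous_comp T T T (iter n f) f x); [exact: IH|exact: cf].
Qed.
Arguments continuous_iter {T f} cf n.

(** A distance that induces the topology. It stands beside the topology instead
    of being a metric structure on [M], so that it can be built inside a proof. *)
Record topology_metric {R : realType} {M : topologicalType} (rho : M -> M -> R) : Prop :=
  TopologyMetric {
    rhoxx : forall x, rho x x = 0;
    rho_sym : forall x y, rho x y = rho y x;
    rho_triangle : forall x y z, rho x z <= rho x y + rho y z;
    rho_sep : forall x y, rho x y = 0 -> x = y;
    nbhs_rho : forall x r, 0 < r -> nbhs x [set y | rho x y < r];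
    rho_nbhs : forall x V, nbhs x V -> exists2 r, 0 < r & [set y | rho x y < r] `<=` V
  }.

Section Metric.
Context {R : realType} {M : ptopologicalType}.
Variable rho : M -> M -> R.
Hypothesis hrho : topology_metric rho.

Lemma rho_ge0 x y : 0 <= rho x y.
Proof.
have := rho_triangle hrho x y x; rewrite (rhoxx hrho) (rho_sym hrho y x); lra.
Qed.

Lemma open_rho_ball x r : open [set y | rho x y < r].
Proof.
rewrite openE => y /= xy; apply: filterS (nbhs_rho hrho y (r := r - rho x y) _); last by lra.
by move=> z /= yz; have := rho_triangle hrho x y z; lra.
Qed.

Lemma rho_totally_bounded (e : R) : compact [set: M] -> 0 < e ->
  exists s : seq M, forall y, exists2 x, x \in s & rho x y < e.
Proof.
rewrite compact_cover => cM e0.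
have [] := cM M [set: M] (fun x => [set y | rho x y < e]).
- by move=> x _; exact: open_rho_ball.
- by move=> y _; exists y => //=; rewrite (rhoxx hrho).
move=> D _ MD; exists (finmap.enum_fset D) => y.
by have [x xD xy] := MD y I; exists x.
Qed.

Definition lipschitz_ball (F : M -> M) (k r : R) (x : M) :=
  forall y z, rho x y < r -> rho x z < r -> rho (F y) (F z) <= k * rho y z.

Definition lipschitz_near (F : M -> M) (k : R) (x : M) :=
  exists2 r, 0 < r & lipschitz_ball F k r x.

Lemma lipschitz_ballW F k k' r r' x : k <= k' -> r' <= r ->
  lipschitz_ball F k r x -> lipschitz_ball F k' r' x.
Proof.
move=> kk rr H y z xy xz; apply: (le_trans (H y z _ _)); try lra.
by rewrite ler_wpM2r// rho_ge0.
Qed.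

Lemma lipschitz_nearW F k k' x : k <= k' -> lipschitz_near F k x -> lipschitz_near F k' x.
Proof. by move=> kk [r r0 H]; exists r => //; exact: lipschitz_ballW H. Qed.

Lemma open_lipschitz_near F k : open [set x | lipschitz_near F k x].
Proof.
rewrite openE => x /= [r r0 H].
apply: filterS (nbhs_rho hrho x (r := r / 2) _); last by lra.
move=> y /= xy; exists (r / 2) => [|u v yu yv]; first by lra.
by apply: H; [have := rho_triangle hrho x y u|have := rho_triangle hrho x y v]; lra.
Qed.

(** Halving the radius leaves room to move the center, so that the points with a
    given radius contain an open, hence Borel, set. *)
Lemma lipschitz_near_interior F k x r : lipschitz_ball F k r x -> 0 < r ->
  (interior [set x | lipschitz_ball F k (r / 2) x]) x.
Proof.
move=> H r0; apply: filterS (nbhs_rho hrho x (r := r / 2) _); last by lra.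
move=> y /= xy u v yu yv.
by apply: H; [have := rho_triangle hrho x y u|have := rho_triangle hrho x y v]; lra.
Qed.

Lemma lipschitz_ball_iter f L r0 N : 1 <= L -> 0 < r0 ->
  (forall x, lipschitz_ball f L r0 x) ->
  exists2 r, 0 < r & forall x, lipschitz_ball (iter N f) (L ^+ N) r x.
Proof.
move=> L1 r00 H; elim: N => [|N [r r_gt0 IH]].
  by exists 1 => // x y z _ _; rewrite expr0 mul1r.
have LN0 : 0 < L ^+ N by rewrite exprn_gt0//; lra.
exists (Num.min r (r0 / L ^+ N)); first by rewrite lt_min r_gt0 divr_gt0.
move=> x y z; rewrite !lt_min => /andP[xy xy'] /andP[xz xz'].
rewrite !iterS exprS -mulrA.
have inb u : rho x u < r -> rho x u < r0 / L ^+ N -> rho (iter N f x) (iter N f u) < r0.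
  rewrite ltr_pdivlMr// => xu; apply: le_lt_trans; rewrite mulrC; apply: (IH x) => //.
  by rewrite (rhoxx hrho).
apply: (le_trans (H _ _ _ (inb y xy xy') (inb z xz xz'))).
by rewrite ler_wpM2l ?(IH x)//; lra.
Qed.

(** With [g] good steps and [c] bad ones, where the bad ones make up at most a
    fraction [1 / (2 (m + 1))] of the total, [m] good steps are spent to offset
    each bad one and at least half of the steps remain as contractions. *)
Lemma pow_contraction (a b : R) (m g c : nat) : 0 <= a -> a <= 2^-1 -> 0 <= b ->
  a ^+ m * b <= 1 -> (m.+1.*2 * c <= g + c)%N ->
  a ^+ g * b ^+ c <= 1 /\ ((4 <= g + c)%N -> a ^+ g * b ^+ c <= 4^-1).
Proof.
move=> a0 a2 b0 ab gc.
have [e [ge eg]] : exists e, g = (m * c + e)%N /\ (g + c <= 2 * e)%N.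
  by exists (g - m * c)%N; split; nia.
have -> : a ^+ g * b ^+ c = (a ^+ m * b) ^+ c * a ^+ e.
  by rewrite ge exprD exprM exprMn; ring.
have p1 : 0 <= (a ^+ m * b) ^+ c <= 1.
  by rewrite exprn_ge0 ?exprn_ile1 ?mulr_ge0 ?exprn_ge0.
have e1 : 0 <= a ^+ e <= 1 by rewrite exprn_ge0// exprn_ile1//; lra.
split=> [|n4]; first by nra.
have e4 : a ^+ e <= 4^-1.
  have -> : e = (2 + (e - 2))%N by lia.
  have h : 0 <= a ^+ (e - 2) <= 1 by rewrite exprn_ge0// exprn_ile1//; lra.
  rewrite exprD expr2; nra.
by nra.
Qed.

Section RecurrentContraction.
Variables (F : M -> M) (E : set M) (a b r : R) (m : nat) (x : M).
Hypotheses (a0 : 0 <= a) (a2 : a <= 2^-1) (b1 : 1 <= b) (ab : a ^+ m * b <= 1).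
Hypothesis FE : forall y, E y -> lipschitz_ball F a r y.
Hypothesis Fb : forall y, lipschitz_ball F b r y.
Hypothesis few_bad : forall n,
  \sum_(j < n) \1_(~` E) (iter j F x) <= (m.+1.*2%:R)^-1 * n%:R :> R.

(** The bound holds from time zero on, without a multiplicative constant. So the
    image of the ball stays in the ball around the image of [x], where the next
    Lipschitz bound applies. *)
Lemma contraction_orbit n : exists p, [/\ 0 <= p, p <= 1, (4 <= n)%N -> p <= 4^-1 &
  forall y z, rho x y < r -> rho x z < r ->
    rho (iter n F y) (iter n F z) <= p * rho y z].
Proof.
pose c n := (\sum_(j < n) (iter j F x \in ~` E))%N.
pose g n := (\sum_(j < n) (iter j F x \in E))%N.
have gc k : (g k + c k = k)%N.
  rewrite /g /c -big_split/= -[RHS]card_ord -sum1_card; apply: eq_bigr => i _.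
  have [Ei|nEi] := pselect (E (iter i F x)).
    by rewrite mem_set// memNset.
  by rewrite memNset// mem_set.
have ck k : (m.+1.*2 * c k <= k)%N.
  have := few_bad k.
  rewrite (eq_bigr (fun j : 'I_k => (iter j F x \in ~` E)%:R)); last by move=> j _; rewrite indicE.
  by rewrite -natr_sum ler_pdivlMl ?ltr0n// -natrM ler_nat.
have pw k := @pow_contraction a b m (g k) (c k) a0 a2 (le_trans ler01 b1) ab.
have b0 : 0 <= b := le_trans ler01 b1.
have ppos k : 0 <= a ^+ g k * b ^+ c k by rewrite mulr_ge0 // exprn_ge0.
exists (a ^+ g n * b ^+ c n); split => //.
- by apply pw; rewrite gc.
- by rewrite -{1}(gc n); apply pw; rewrite gc.
elim: n => [|n IH] y z xy xz; first by rewrite /g /c !big_ord0 !mul1r.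
have pn1 : a ^+ g n * b ^+ c n <= 1 by apply pw; rewrite gc.
have inb u : rho x u < r -> rho (iter n F x) (iter n F u) < r.
  move=> xu; apply: (le_lt_trans _ xu).
  have xx : rho x x < r by rewrite (rhoxx hrho); exact: le_lt_trans (rho_ge0 _ _) xy.
  by apply: (le_trans (IH x u xx xu)); rewrite ler_piMl// rho_ge0.
rewrite /g /c !big_ord_recr/= -/(g n) -/(c n).
have [En|nEn] := pselect (E (iter n F x)).
  rewrite mem_set// memNset// addn0 addn1 exprS.
  rewrite [X in X * _](_ : _ = a * (a ^+ g n * b ^+ c n)); last by ring.
  apply: (le_trans (FE En (inb y xy) (inb z xz))).
  by rewrite -mulrA ler_wpM2l// IH.
rewrite memNset// mem_set// addn0 addn1 exprS [X in X * _](_ : _ = b * (a ^+ g n * b ^+ c n)); last by ring.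
apply: (le_trans (Fb (inb y xy) (inb z xz))).
by rewrite -mulrA ler_wpM2l// IH.
Qed.

(** Let [D] be the distance from [x] to [G x], where [G = F^n] brings [x] into
    its ball. At a time [k >= 4] with [F^k x] within [D / 8] of [x], the triangle
    inequality bounds [D] by the distance from [F^k x] to [F^k (G x)], at most
    [D / 4], plus two errors of at most [D / 8]. So [D = 0]. *)
Lemma recurrent_contraction_periodic : 0 < r ->
  (forall e, 0 < e -> forall K, exists2 n, (K <= n)%N & rho x (iter n F x) < e) ->
  exists2 n, (0 < n)%N & iter n F x = x.
Proof.
move=> r0 rec.
have [n n0 xn] := rec r r0 1%N.
exists n => //; apply/esym/(rho_sep hrho)/eqP/negPn/negP => D0.
set D := rho x (iter n F x) in D0 xn.
have Dgt0 : 0 < D by rewrite lt_neqAle eq_sym D0 rho_ge0.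
(* The time 4 is the one from which the factor is at most 1/4. *)
have [|k k4] := rec (Num.min r (D / 8)) _ 4%N; first by rewrite lt_min r0; lra.
rewrite lt_min => /andP[xk xk8].
have xx : rho x x < r by rewrite (rhoxx hrho).
have [p [p0 p1 _ Hp]] := contraction_orbit n.
have [q [q0 q1 /(_ k4) q4 Hq]] := contraction_orbit k.
have h1 := Hp _ _ xx xk.
have h2 := Hq _ _ xx xn.
rewrite -/D -!iterD addnC iterD in h1 h2 *.
have t1 := rho_triangle hrho x (iter k F x) (iter n F x).
have t2 := rho_triangle hrho (iter k F x) (iter k F (iter n F x)) (iter n F x).
rewrite (rho_sym hrho (iter k F (iter n F x))) in t2.
rewrite -/D in t1.
have := rho_ge0 x (iter k F x).
nra.
Qed.

End RecurrentContraction.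
End Metric.

(** * Periodicity of almost every exponentially contracted point *)

Lemma geometric_small {R : realType} (z K e : R) : 0 <= z -> z < 1 -> 0 < e ->
  exists N0, forall N, (N0 <= N)%N -> K * z ^+ N <= e.
Proof.
move=> z0 z1 e0.
have : K * z ^+ N @[N --> \oo] --> K * 0.
  by apply: cvgMr; apply: cvg_expr; rewrite ger0_norm.
rewrite mulr0 => /cvgr_le/(_ _ e0)[N0 _ H].
by exists N0 => N NN0; exact: H.
Qed.

Section StablePeriodic.
Context {R : realType} {M : ptopologicalType}.
Variable rho : M -> M -> R.
Hypothesis hrho : topology_metric rho.
Variable f : M -> M.

Definition periodic (x : M) := exists2 n, (0 < n)%N & iter n f x = x.

(** The metric form of a negative exponent. The radius of the ball may depend on
    [n]. *)
Definition exp_lipschitz (l C : R) (x : M) :=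
  forall n, lipschitz_near rho (iter n f) (C * l ^+ n) x.

Lemma exp_lipschitzW (l l' K K' : R) x :
  0 <= l -> l <= l' -> K <= K' -> 0 <= K' ->
  exp_lipschitz l K x -> exp_lipschitz l' K' x.
Proof.
move=> l0 ll KK K0 H n; apply: (lipschitz_nearW hrho _ (H n)).
apply: (@le_trans _ _ (K' * l ^+ n)); first by rewrite ler_wpM2r ?exprn_ge0.
by rewrite ler_wpM2l// lerXn2r// nnegrE (le_trans l0).
Qed.

Let stable k (x : M) := exists n, [/\ (0 < n)%N, iter n f x = x &
  lipschitz_ball rho (iter n f) 2^-1 k.+1%:R^-1 x].

(** A multiple of the period is long enough for the factor [C * l ^ n] to drop
    below one half. *)
Let stable_periodic l C x : 0 < l -> l < 1 -> periodic x -> exp_lipschitz l C x ->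
  exists k, stable k x.
Proof.
move=> l0 l1 [n n0 nx] HC.
have [N0 HN0] := @geometric_small _ l C 2^-1 (ltW l0) l1 ltac:(lra).
have [r r_gt0 Hr] := HC (N0.+1 * n)%N.
have [k _ Hk] := near_infty_natSinv_lt (PosNum r_gt0).
exists k, (N0.+1 * n)%N; split; first by rewrite muln_gt0.
  exact: iter_period.
apply: (lipschitz_ballW hrho _ _ Hr); last by exact: ltW (Hk k (leqnn k)).
by apply: HN0; nia.
Qed.

(** Iterating the period map of [x] brings [y] to [x]; but the [m]-th iterate,
    [m] a period of [y], fixes [y]. *)
Let stable_separated k x y : stable k x -> stable k y -> rho x y < k.+1%:R^-1 -> x = y.
Proof.
move=> [n [n0 nx Hx]] [m [m0 my _]] xy; apply: (rho_sep hrho).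
have k0 : 0 < k.+1%:R^-1 :> R by rewrite invr_gt0.
have H j : rho x (iter j (iter n f) y) <= 2^-1 ^+ j * rho x y.
  elim: j => [|j IH]; first by rewrite mul1r.
  have le1 : 2^-1 ^+ j <= 1 :> R by rewrite exprn_ile1//; lra.
  have inb : rho x (iter j (iter n f) y) < k.+1%:R^-1.
    by apply: le_lt_trans xy; apply: (le_trans IH); rewrite ler_piMl// (rho_ge0 hrho).
  have xx : rho x x < k.+1%:R^-1 by rewrite (rhoxx hrho).
  have := Hx _ _ xx inb; rewrite nx iterS exprS -mulrA => /le_trans; apply.
  by rewrite ler_wpM2l//; lra.
have := H m; rewrite -iterM mulnC iterM.
have -> : iter n (iter m f) y = y by rewrite -iterM iter_period.
have : 2^-1 ^+ m <= 2^-1 :> R.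
  by case: m m0 {my H} => // m _; rewrite exprS ler_piMr ?exprn_ile1//; lra.
have := rho_ge0 hrho x y; nra.
Qed.

(** By total boundedness only finitely many points can be pairwise
    [1 / (k + 1)]-apart. *)
Lemma countable_stable_periodic : compact [set: M] -> countable
  [set x | periodic x /\ exists l C, [/\ 0 < l, l < 1 & exp_lipschitz l C x]].
Proof.
move=> cM; apply: (@sub_countable _ _ _ (\bigcup_k [set x | stable k x])).
  apply: subset_card_le => x [px [l [C [l0 l1 HC]]]].
  by have [k Hk] := stable_periodic l0 l1 px HC; exists k.
apply: bigcup_countable => [|k _]; first exact: countableP.
have k0 : 0 < k.+1%:R^-1 / 2 :> R by rewrite divr_gt0.
have [s Hs] := rho_totally_bounded hrho cM k0.
apply: (@sub_countable _ _ _
  (\bigcup_i [set x | stable k x /\ rho (nth point s i) x < k.+1%:R^-1 / 2])).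
  apply: subset_card_le => x sx; have [z zs zx] := Hs x.
  by exists (index z s) => //; split => //; rewrite nth_index.
apply: bigcup_countable => [|i _]; first exact: countableP.
have [->|/set0P[x [sx ix]]] := eqVneq [set x | stable k x /\ rho (nth point s i) x < k.+1%:R^-1 / 2] set0.
  exact: countable0.
apply: (@sub_countable _ _ _ [set x]); last exact: countable1.
apply: subset_card_le => y [sy iy]; apply: (stable_separated sy sx).
apply: (le_lt_trans (rho_triangle hrho y (nth point s i) x)).
by rewrite (splitr k.+1%:R^-1) ltrD// (rho_sym hrho).
Qed.

End StablePeriodic.

Section Borel.
Context {M : ptopologicalType}.

Lemma open_borel (A : set M) : open A -> measurable (A : set (borel M)).
Proof. by move=> oA; exact: sub_gen_smallest. Qed.

Lemma continuous_borel (f : M -> M) : continuous f ->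
  measurable_fun [set: borel M] (f : borel M -> borel M).
Proof.
move=> /continuousP cf; apply: (@measurability _ _ (borel M) (borel M) setT f (@open M)) => //.
by move=> _ [A oA <-]; rewrite setTI; exact: open_borel (cf A oA).
Qed.

Lemma closed_borel (A : set M) : closed A -> measurable (A : set (borel M)).
Proof.
move=> cA; rewrite -(setCK A); apply: measurableC; apply: open_borel.
exact: closed_openC.
Qed.

End Borel.

Lemma measure_setD_small {disp} {T : measurableType disp} {R : realType}
    (mu : probability T R) (B : set T) (A : nat -> set T) (e : R) : 0 < e ->
  measurable B -> (forall n, measurable (A n)) -> (forall n, A n `<=` A n.+1) ->
  B `<=` \bigcup_n A n -> exists n, (mu (B `\` A n) <= e%:E)%E.
Proof.
move=> e0 mB mA ndA BA.
have mBA n : measurable (B `\` A n) by exact: measurableD.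
have : mu (B `\` A n) @[n --> \oo] --> mu (\bigcap_n (B `\` A n)).
  apply: nonincreasing_cvg_mu => //.
  - by rewrite -ge0_fin_numE// fin_num_measure.
  - exact: bigcapT_measurable.
  - apply/nonincreasing_seqP => n; apply/subsetPset => x [Bx nAx]; split => //.
    by move=> /ndA.
have -> : \bigcap_n (B `\` A n) = set0.
  apply/seteqP; split=> // x Hx.
  have [Bx _] := Hx 0%N I.
  by have [n _ An] := BA _ Bx; have [_] := Hx n I.
rewrite measure0 => H; apply: contrapT => /forallNP small.
have : (e%:E <= limn (fun n => mu (B `\` A n)))%E.
  apply: lime_ge; first by apply/cvg_ex; exists 0%E.
  by apply: nearW => n; rewrite leNgt; apply/negP => /ltW/small.
by rewrite (cvg_lim _ H)// leNgt lte_fin e0.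
Qed.

Section AlmostPeriodic.
Context {R : realType} {M : ptopologicalType}.
Variable rho : M -> M -> R.
Hypothesis hrho : topology_metric rho.
Hypothesis cM : compact [set: M].
Variables (f : M -> M) (mu : probability (borel M) R).
Hypothesis cf : continuous f.
Hypothesis mu_f : invariant_measure f mu.

Let mf : measurable_fun [set: borel M] (f : borel M -> borel M) := continuous_borel cf.

Definition recurrent (F : M -> M) (x : M) :=
  forall e : R, 0 < e -> forall K, exists2 n, (K <= n)%N & rho x (iter n F x) < e.

(** Returns are applied to the balls of a countable family: finite covers by balls
    of radius [1 / (k + 1)]. *)
Lemma ae_recurrent N : mu.-negligible (~` [set x : borel M | recurrent (iter N f) x]).
Proof.
pose ret (A : set M) := [set x | forall K, exists2 n, (K <= n)%N & A (iter n (iter N f) x)].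
have mN := measurable_fun_iter mf N.
have muN (A : set (borel M)) : measurable A -> mu (iter N f @^-1` A) = mu A.
  by move=> mA; exact: (measure_iter mf mu_f).
pose bad (k : nat) (s : seq M) := \bigcup_i ([set y | rho (nth point s i) y < k.+1%:R^-1] `\`
  ret [set y | rho (nth point s i) y < k.+1%:R^-1]).
have nb k s : mu.-negligible (bad k s).
  apply: negligible_bigcup => i; apply: (poincare_recurrence mN muN).
  exact: open_borel (open_rho_ball hrho _ _).
have [s Hs] : {s : nat -> seq M & forall k y, exists2 x, x \in s k & rho x y < k.+1%:R^-1}.
  by apply: (@choice _ _ (fun k s => forall y, exists2 x, x \in s & rho x y < k.+1%:R^-1)) => k;
    apply: (rho_totally_bounded hrho cM); rewrite invr_gt0.
apply: (@negligibleS _ _ _ mu (\bigcup_k bad k (s k))); last exact: negligible_bigcup.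
move=> x /= /existsNP[e /not_implyP[e0 /existsNP[K nK]]].
have [k ke] : exists k : nat, k.+1%:R^-1 < e / 2.
  have [k _ Hk] := near_infty_natSinv_lt (PosNum (divr_gt0 e0 (ltr0Sn _ 1))).
  by exists k; exact: (Hk k (leqnn k)).
exists k => //.
have [z zs zx] := Hs k x.
exists (index z (s k)) => //; rewrite nth_index//; split => //.
move=> /(_ K)[n Kn /= zn]; apply: nK; exists n => //.
apply: (le_lt_trans (rho_triangle hrho x z _)).
by rewrite (splitr e) ltrD// (lt_trans _ ke)// (rho_sym hrho).
Qed.

Variables (L r0 lam : R).
Hypotheses (L1 : 1 <= L) (r00 : 0 < r0) (fL : forall x, lipschitz_ball rho f L r0 x).
Hypotheses (lam0 : 0 < lam) (lam1 : lam < 1).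

Let L0 : 0 < L := lt_le_trans ltr01 L1.

(** The points moved less than a given distance by [f^n] form an open set. *)
Lemma measurable_periodic : measurable (periodic f : set (borel M)).
Proof.
have -> : periodic f = \bigcup_(n in [set n | (0 < n)%N]) \bigcap_k
    [set x | exists2 y, y = iter n f x & rho x y < k.+1%:R^-1].
  apply/seteqP; split=> x.
    move=> [n n0 nx]; exists n => // k _; exists x; first by rewrite nx.
    by rewrite (rhoxx hrho) invr_gt0.
  move=> [n n0 Hn]; exists n => //; apply/esym/(rho_sep hrho)/eqP/negPn/negP => D0.
  have D1 : 0 < rho x (iter n f x) by rewrite lt_neqAle eq_sym D0 (rho_ge0 hrho).
  have [k _ Hk] := near_infty_natSinv_lt (PosNum D1).
  have [y -> ] := Hn k I.
  by move=> /lt_trans/(_ (Hk k (leqnn k))); rewrite ltxx.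
apply: bigcup_measurable => n _; apply: bigcapT_measurable => k.
apply: open_borel; rewrite openE => x [_ -> xn].
set D := rho x (iter n f x) in xn.
have e0 : 0 < (k.+1%:R^-1 - D) / 2 by rewrite divr_gt0// subr_gt0.
have N1 := nbhs_rho hrho x e0.
have N2 := continuous_iter cf n x _ (nbhs_rho hrho (iter n f x) e0).
apply: filterS2 N1 N2 => y /= xy xny; exists (iter n f y) => //.
have := rho_triangle hrho y x (iter n f y).
have := rho_triangle hrho x (iter n f x) (iter n f y).
by move: xy xny; rewrite /= -/D (rho_sym hrho y x); move: (_^-1) => w; lra.
Qed.

Let B : set (borel M) := [set x | exists C : nat, exp_lipschitz rho f lam C%:R x].

Let mB : measurable B.
Proof.
have -> : B = \bigcup_C \bigcap_n [set x | lipschitz_near rho (iter n f) (C%:R * lam ^+ n) x].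
  apply/seteqP; split=> x.
    by move=> [C HC]; exists C => // n _; exact: HC.
  by move=> [C _ HC]; exists C => n; exact: HC.
apply: bigcup_measurable => C _; apply: bigcapT_measurable => n.
exact: open_borel (open_lipschitz_near hrho _ _).
Qed.

(** One more application of [f] costs one factor [L], absorbed by the constant.
    Allowing an arbitrary constant in the definition of [B] is what makes [B]
    backward invariant. *)
Let B_preimage : f @^-1` B `<=` B.
Proof.
move=> x [C HC].
have [C' HC'] : exists C' : nat, 1 <= C'%:R :> R /\ C%:R * L / lam <= C'%:R.
  exists (Num.truncn (Num.max 1 (C%:R * L / lam))).+1.
  have := truncnS_gt (Num.max 1 (C%:R * L / lam)).
  by rewrite gt_max => /andP[/ltW ? /ltW ?].
exists C' => n; case: n => [|n].
  exists 1 => // y z _ _.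
  by rewrite /= expr0 mulr1 ler_peMl ?(rho_ge0 hrho)//; case: HC'.
have [r r_gt0 Hr] := HC n.
exists (Num.min r0 (r / L)); first by rewrite lt_min r00 divr_gt0.
move=> y z; rewrite !lt_min => /andP[xy xy'] /andP[xz xz'].
have xx : rho x x < r0 by rewrite (rhoxx hrho).
have inb u : rho x u < r0 -> rho x u < r / L -> rho (f x) (f u) < r.
  move=> xu; rewrite ltr_pdivlMr//.
  by apply: le_lt_trans; rewrite mulrC; exact: fL xx xu.
rewrite !iterSr.
have h := Hr _ _ (inb y xy xy') (inb z xz xz').
apply: (le_trans h).
have h2 : C%:R * lam ^+ n * rho (f y) (f z) <= C%:R * lam ^+ n * (L * rho y z).
  by rewrite ler_wpM2l ?(fL xy xz)// mulr_ge0// exprn_ge0// ltW.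
apply: (le_trans h2).
rewrite mulrA ler_wpM2r ?(rho_ge0 hrho)// exprS.
case: HC' => _; rewrite ler_pdivrMr// => HC'.
have : 0 <= lam ^+ n by rewrite exprn_ge0// ltW.
nra.
Qed.

Let contracted N (a : R) (r : R) : set (borel M) :=
  interior [set x | lipschitz_ball rho (iter N f) a r x].

(** The bounded constants [C] and the radii exhaust [B], so both may be fixed at
    the price of a small measure. Then [a = C * lam ^ N] satisfies
    [a ^ m * L ^ N = C ^ m * (lam ^ m * L) ^ N], which tends to zero: the
    threshold [m] is chosen before [N]. *)
Lemma contracting_iterate (e : R) (m : nat) : 0 < e -> lam ^+ m * L <= 2^-1 ->
  exists N a r, [/\ (0 < N)%N, 0 <= a /\ a <= 2^-1, a ^+ m * L ^+ N <= 1, 0 < r &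
   (forall x, lipschitz_ball rho (iter N f) (L ^+ N) r x) /\
   (mu (B `\` contracted N a r) <= e%:E)%E].
Proof.
move=> e0 lamL.
pose BC (C : nat) : set (borel M) := \bigcap_n [set x | lipschitz_near rho (iter n f) (C%:R * lam ^+ n) x].
have mBC C : measurable (BC C).
  by apply: bigcapT_measurable => n; exact: open_borel (open_lipschitz_near hrho _ _).
have e20 : 0 < e / 2 by lra.
have [C HC] : exists C, (mu (B `\` BC C) <= (e / 2)%:E)%E.
  apply: measure_setD_small => //.
    move=> C x Hx n _; apply: lipschitz_nearW (Hx n I) => //.
    by rewrite ler_wpM2r ?ler_nat// exprn_ge0// ltW.
  by move=> x [C HC]; exists C => // n _; exact: HC.
have [N1 HN1] := @geometric_small _ lam C%:R 2^-1 (ltW lam0) lam1 ltac:(lra).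
have [N2 HN2] := @geometric_small _ (2^-1) (C%:R ^+ m) 1 ltac:(lra) ltac:(lra) ltr01.
(* The successor keeps [N] positive: periods of [f^N] must give periods of [f]. *)
pose N := (maxn N1 N2).+1; pose a : R := C%:R * lam ^+ N.
have [rN rN0 HrN] := lipschitz_ball_iter hrho N L1 r00 fL.
pose U : set (borel M) := [set x | lipschitz_near rho (iter N f) a x].
pose r k : R := rN / k.+1%:R.
have r_gt0 k : 0 < r k by rewrite divr_gt0.
have [k Hk] : exists k, (mu (U `\` contracted N a (r k)) <= (e / 2)%:E)%E.
  apply: measure_setD_small => //.
  - exact: open_borel (open_lipschitz_near hrho _ _).
  - by move=> k; apply: open_borel; exact: open_interior.
  - move=> k; apply: interiorS => x /=; apply: lipschitz_ballW => //.
    by rewrite ler_pM2l// lef_pV2 ?posrE// ler_nat.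
  - move=> x [s s0 Hs].
    have [k _ Hkk] := near_infty_natSinv_lt (PosNum (divr_gt0 (divr_gt0 s0 rN0) (ltr0Sn R 1))).
    exists k => //; have := lipschitz_near_interior hrho Hs s0.
    apply: interiorS => y /=; apply: lipschitz_ballW => //.
    have /= := ltW (Hkk k (leqnn k)).
    by move=> h; rewrite /r mulrC -ler_pdivlMr// mulrAC.
exists N, a, (r k); split => //.
- split; first by rewrite mulr_ge0// exprn_ge0// ltW.
  by apply: HN1; rewrite leqW// leq_maxl.
- have -> : a ^+ m * L ^+ N = C%:R ^+ m * (lam ^+ m * L) ^+ N.
    by rewrite /a !exprMn -!exprM mulnC mulrA.
  apply: le_trans (HN2 N (leqW (leq_maxr _ _))).
  have p0 : 0 <= lam ^+ m * L by rewrite mulr_ge0 ?exprn_ge0 ?ltW.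
  by rewrite ler_wpM2l ?exprn_ge0// lerXn2r// nnegrE invr_ge0.
split.
  move=> x; apply: (@lipschitz_ballW _ _ _ hrho _ _ _ _ _ _ _ _ (HrN x)) => //.
  by rewrite ler_pdivrMr// ler_peMr ?ler1n// ltW.
have mE : measurable (contracted N a (r k)) by apply: open_borel; exact: open_interior.
have mU : measurable U by exact: open_borel (open_lipschitz_near hrho _ _).
apply: (@le_trans _ _ (mu ((B `\` BC C) `|` (U `\` contracted N a (r k))))).
  apply: le_measure; rewrite ?inE; [exact: measurableD|by apply: measurableU; exact: measurableD|].
  move=> x [Bx nEx].
  have [BCx|nBCx] := pselect (BC C x); last by left.
  by right; split => //; exact: BCx N I.
apply: (le_trans (measureU2 _ _ _)); [exact: measurableD|exact: measurableD|].
by rewrite [e in leRHS]splitr EFinD leeD.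
Qed.

(** Since [m] is fixed first, the exceptional set of the maximal inequality can be
    made as small as wanted by the choice of [N]. *)
Lemma negligible_not_periodic : mu.-negligible (B `\` periodic f).
Proof.
have [m Hm] := @geometric_small _ lam L 2^-1 (ltW lam0) lam1 ltac:(lra).
have lamL : lam ^+ m * L <= 2^-1 by rewrite mulrC Hm.
pose theta : R := (m.+1.*2%:R)^-1.
have theta0 : 0 < theta by rewrite invr_gt0 ltr0n.
have miB j : measurable (iter j f @^-1` B : set (borel M)).
  by rewrite -[X in measurable X]setTI; exact: measurable_fun_iter.
(* [B] contains its preimages, which have the same measure. *)
have leave : mu.-negligible (\bigcup_j (B `\` iter j f @^-1` B)).
  apply: negligible_bigcup => j; exists (B `\` iter j f @^-1` B); split => //.
    exact: measurableD.
  have sub : iter j f @^-1` B `<=` B.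
    by elim: j => [//|j IH] x; rewrite /= => fB; apply: IH; exact: B_preimage.
  rewrite measureD//; last by rewrite -ge0_fin_numE// fin_num_measure.
  by rewrite setIidr// [X in (_ - X)%E](measure_iter mf mu_f)// subee// fin_num_measure.
have mBP : measurable (B `\` periodic f : set (borel M)).
  by apply: measurableD => //; exact: measurable_periodic.
apply/negligibleP => //; apply/eqP; rewrite -measure_le0; apply/lee_addgt0Pr => e e0.
rewrite add0e.
have [||N [a [r [N0 [a0 a2] ab r_gt0 [fN BE]]]]] := @contracting_iterate (theta * e) m.
- exact: mulr_gt0.
- by [].
set E := contracted N a r in BE.
have mE : measurable E by apply: open_borel; exact: open_interior.
have mN : measurable_fun [set: borel M] (iter N f : borel M -> borel M).
  exact: (measurable_fun_iter mf N).
have muN (A : set (borel M)) : measurable A -> mu (iter N f @^-1` A) = mu A.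
  by move=> mA; exact: (measure_iter mf mu_f).
have [Z [mZ muZ HZ]] := maximal_inequality mN muN (measurableD mB mE) theta0.
have {}muZ : (mu Z <= e%:E)%E.
  by rewrite -(@lee_pmul2l _ theta%:E)// -?EFinM// (le_trans muZ).
have [Y [mY Y0 YN]] := negligibleU leave (ae_recurrent N).
have sub : B `\` periodic f `<=` Z `|` Y.
  move=> x [Bx nper]; apply: contrapT => /not_orP[nZ nY].
  have stay j : B (iter j f x).
    by apply: contrapT => nB; apply: nY; apply: YN; left; exists j.
  have rec : recurrent (iter N f) x.
    by apply: contrapT => nrec; apply: nY; apply: YN; right.
  apply: nper.
  have [| |n n0 nx] := recurrent_contraction_periodic hrho a0 a2 (exprn_ege1 N L1) ab
    (E := E) _ fN _ r_gt0 rec (m := m).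
  + by move=> y /interior_subset.
  + move=> n; apply: le_trans (HZ x nZ n); apply: ler_sum => j _.
    rewrite !indicE; have [Ej|nEj] := pselect (E (iter j (iter N f) x)).
      by rewrite memNset.
    rewrite mem_set//; rewrite mem_set//; split => //.
    by rewrite -iterM; exact: stay.
  by exists (n * N)%N; rewrite ?muln_gt0 ?n0// iterM.
apply: (@le_trans _ _ (mu (Z `|` Y))).
  by apply: le_measure; rewrite ?inE//; exact: measurableU.
by apply: (le_trans (measureU2 _ _ _)) => //; rewrite Y0 adde0.
Qed.

End AlmostPeriodic.

(** * Measures carried by countably many periodic points *)

Section Orbits.
Context {T : Type}.
Variable f : T -> T.

Lemma orbit_set_eq n x y : (0 < n)%N -> iter n f x = x -> orbit_set f x y ->
  orbit_set f y = orbit_set f x.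
Proof.
move=> n0 nx [k _ <-]; apply/seteqP; split=> z [j _ <-].
  by exists (j + k)%N => //; rewrite iterD.
exists (j + (k * n - k))%N => //.
by rewrite iterD -[in X in _ X = _](iterD _ k) subnK ?leq_pmulr// iter_period.
Qed.

Lemma orbit_set_refl x : orbit_set f x x.
Proof. by exists 0%N. Qed.

Lemma orbit_set_step x y : orbit_set f x y -> orbit_set f x (f y).
Proof. by move=> [n _ <-]; exists n.+1. Qed.

End Orbits.

Lemma minimal_period {T : eqType} (f : T -> T) x n : (0 < n)%N -> iter n f x = x ->
  exists t, [/\ (0 < t)%N, iter t f x = x,
    (forall i j, (i < t)%N -> (j < t)%N -> iter i f x = iter j f x -> i = j) &
    forall y, orbit_set f x y -> exists2 j, (j < t)%N & iter j f x = y].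
Proof.
move=> n0 nx.
have ex : exists n, (0 < n)%N && (iter n f x == x) by exists n; rewrite n0 nx eqxx.
case: (ex_minnP ex) => t /andP[t0 /eqP tx] tmin.
have inj i j : (i < j)%N -> (j < t)%N -> iter i f x <> iter j f x.
  move=> ij jt E.
  have /tmin : (0 < t - j + i)%N && (iter (t - j + i) f x == x).
    rewrite addn_gt0 subn_gt0 jt/= iterD E -iterD subnK ?tx//; exact: ltnW.
  by lia.
exists t; split => //.
  move=> i j it jt E; apply/eqP; case: ltngtP => // lt; exfalso.
    exact: inj lt jt E.
  by apply: inj lt it _; rewrite E.
move=> y [k _ <-]; exists (k %% t)%N; first by rewrite ltn_mod.
by rewrite [in RHS](divn_eq k t) addnC iterD iter_period.
Qed.

Section Decomposition.
Context {R : realType} {M : ptopologicalType}.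
Variables (f : M -> M) (mu : probability (borel M) R).
Hypothesis cf : continuous f.
Hypothesis mu_f : invariant_measure f mu.
Hypothesis m1 : forall x : M, measurable ([set x] : set (borel M)).
Variable S : set M.
Hypothesis cS : countable S.
Hypothesis perS : forall x, S x -> exists2 n, (0 < n)%N & iter n f x = x.
Hypothesis nS : mu.-negligible (~` S : set (borel M)).

Let mf : measurable_fun [set: borel M] (f : borel M -> borel M) := continuous_borel cf.

(** The preimage of the singleton of [f^k x] contains [x]. *)
Let mass_iter k x : (mu [set x] <= mu [set iter k f x])%E.
Proof.
rewrite -(measure_iter mf mu_f k (m1 (iter k f x))).
apply: le_measure; rewrite ?inE//; last by move=> _ ->.
by rewrite -[X in measurable X]setTI; exact: (measurable_fun_iter mf k).
Qed.

Let mass_orbit x y : S x -> orbit_set f x y -> mu [set y] = mu [set x].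
Proof.
move=> Sx xy; have [n n0 nx] := perS Sx.
have [k _ yx] : orbit_set f y x.
  by rewrite (orbit_set_eq n0 nx xy); exact: orbit_set_refl.
apply/le_anti/andP; split; first by rewrite -yx; exact: mass_iter.
by case: xy => j _ <-; exact: mass_iter.
Qed.

Let measurable_orbit x : S x -> measurable (orbit_set f x : set (borel M)).
Proof.
move=> Sx.
have -> : orbit_set f x = \bigcup_n [set iter n f x].
  by apply/seteqP; split=> [y [n _ <-]|y [n _ ->]]; exists n.
exact: bigcup_measurable.
Qed.

Lemma restriction_orbit_dirac x (mO : measurable (orbit_set f x : set (borel M))) :
  S x -> (0 < mu [set x])%E -> multiple_of_orbit_dirac f x (mrestr mu mO).
Proof.
move=> Sx mx0; have [n n0 nx] := perS Sx.
have [t [t0 tx tinj tonto]] := minimal_period n0 nx.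
have fin : mu [set x] \is a fin_num by rewrite fin_num_measure.
have c0 : 0 < fine (mu [set x]).
  by rewrite fine_gt0// mx0/= -ge0_fin_numE.
exists t, (t%:R * fine (mu [set x])); split=> [//|//||A mA].
  by rewrite mulr_gt0// ltr0n.
have t1 : t%:R != 0 :> R by rewrite pnatr_eq0 -lt0n.
rewrite /equidistributed_dirac muleA -EFinM mulrAC divff// mul1r fineK//.
rewrite /mrestr.
pose F i := A `&` [set iter i f x].
have mF i : measurable (F i) by exact: measurableI.
have -> : A `&` orbit_set f x = \big[setU/set0]_(i < t) F i.
  rewrite -bigcup_mkord; apply/seteqP; split=> y.
    by move=> [Ay /tonto[j jt jy]]; exists j => //; split.
  by move=> [j jt [/[swap] -> Ay]]; split => //; exists j.
rewrite measure_semi_additive_ord_I//; last 2 first.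
- by move=> i j it jt [y [[_ /= ->] [_ /= E]]]; exact: tinj it jt E.
- exact: bigsetU_measurable.
rewrite ge0_sume_distrr; last by move=> i _; rewrite diracE lee_fin.
apply: eq_bigr => i _; rewrite /F diracE.
have [Ai|nAi] := pselect (A (iter i f x)).
  rewrite mem_set// mule1 -(mass_orbit Sx (y := iter i f x)); last by exists i.
  by congr (mu _); apply/seteqP; split=> [y []//|y ->].
rewrite memNset// mule0 (_ : _ `&` _ = set0) ?measure0//.
by apply/seteqP; split=> // y [Ay yx]; apply: nAi; rewrite -yx.
Qed.

(** One representative is chosen per orbit, as a value that depends only on the
    orbit, and orbits are numbered by the rank of the representative in a
    numbering of [S]. Orbits of mass zero are dropped. *)
Theorem orbit_decomposition : exists (I : set nat) (p : nat -> M)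
    (mus : nat -> {measure set (borel M) -> \bar R}),
  [/\ (forall i, I i -> [/\ S (p i), (0 < mu [set p i])%E &
         multiple_of_orbit_dirac f (p i) (mus i)]),
      set_inj I (fun i => orbit_set f (p i)) &
      forall A : set (borel M), measurable A -> mu A = \esum_(i in I) mus i A].
Proof.
have /countable_injP[h hinj] := cS.
(* The choice only sees the orbit as a set, so it is constant on orbits. *)
pose rep x := xget point (orbit_set f x `&` S).
have repP x : S x -> orbit_set f x (rep x) /\ S (rep x).
  move=> Sx; apply: (@xgetPex _ point (orbit_set f x `&` S)).
  by exists x; split => //; exact: orbit_set_refl.
have rep_orbit x : S x -> orbit_set f (rep x) = orbit_set f x.
  by move=> Sx; have [n n0 nx] := perS Sx; have [/(orbit_set_eq n0 nx)] := repP x Sx.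
pose Rp := [set rep x | x in [set x | S x /\ (0 < mu [set x])%E]].
have RpS r : Rp r -> S r by move=> [x [Sx _] <-]; have [] := repP x Sx.
have Rp0 r : Rp r -> (0 < mu [set r])%E.
  by move=> [x [Sx m0] <-]; have [xr _] := repP x Sx; rewrite (mass_orbit Sx xr).
have Rp_inj r r' : Rp r -> Rp r' -> orbit_set f r = orbit_set f r' -> r = r'.
  move=> [x [Sx _] <-] [y [Sy _] <-]; rewrite !rep_orbit// => E.
  by rewrite /rep E.
pose p i := xget point [set x | Rp x /\ h x = i].
pose I := h @` Rp.
have pP i : I i -> Rp (p i) /\ h (p i) = i.
  by move=> [r Rr hr]; apply: (@xgetPex _ point [set x | Rp x /\ h x = i]); exists r.
have mO i : measurable ((if `[< I i >] then orbit_set f (p i) else set0) : set (borel M)).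
  by case: asboolP => // Ii; apply: measurable_orbit; apply: RpS; have [] := pP i Ii.
pose mus i : {measure set (borel M) -> \bar R} := mrestr mu (mO i).
have pinj : set_inj I (fun i => orbit_set f (p i)).
  move=> i j; rewrite !inE => /pP[Ri hi] /pP[Rj hj] E.
  by rewrite -hi -hj (Rp_inj _ _ Ri Rj E).
exists I, p, mus; split => //.
  move=> i Ii; have [Ri _] := pP i Ii; have Si := RpS _ Ri.
  split=> //; first exact: Rp0.
  have [t [c [t0 tx c0 H]]] := restriction_orbit_dirac (measurable_orbit Si) Si (Rp0 _ Ri).
  exists t, c; split => // A mA; rewrite -H//= /mrestr.
  by rewrite asboolT.
move=> A mA.
pose F i := A `&` orbit_set f (p i).
have mF i : I i -> measurable (F i).
  move=> Ii; apply: measurableI => //; apply: measurable_orbit; apply: RpS.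
  by have [] := pP i Ii.
have tF : trivIset I F.
  move=> i j Ii Ij [z [[_ iz] [_ jz]]]; apply: pinj; rewrite ?inE//.
  have [/RpS/perS[n n0 nx] _] := pP i Ii; have [/RpS/perS[k k0 kx] _] := pP j Ij.
  by rewrite -(orbit_set_eq n0 nx iz) (orbit_set_eq k0 kx jz).
have mU : measurable (\bigcup_(i in I) F i) by exact: bigcup_measurable.
have negl : mu.-negligible (A `\` \bigcup_(i in I) F i).
  have null : mu.-negligible (\bigcup_n [set x | [/\ S x, h x = n & mu [set x] = 0%E]]).
    apply: negligible_bigcup => n.
    have [->|/set0P[x [Sx hx x0]]] := eqVneq [set x | [/\ S x, h x = n & mu [set x] = 0%E]] set0.
      exact: negligible_set0.
    exists [set x]; split => // y [Sy hy _]; apply: hinj; rewrite ?inE//.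
    by rewrite hy hx.
  apply: negligibleS (negligibleU nS null) => x [Ax nx].
  have [Sx|nSx] := pselect (S x); last by left.
  right; exists (h x) => //; split => //; apply/eqP; rewrite -measure_le0 leNgt.
  apply/negP => m0; apply: nx.
  have Rr : Rp (rep x) by exists x.
  have Ir : I (h (rep x)) by exists (rep x).
  exists (h (rep x)) => //; split => //.
  have [Rq hq] := pP _ Ir.
  have -> : p (h (rep x)) = rep x by apply: hinj; rewrite ?inE//; exact: RpS.
  by rewrite rep_orbit//; exact: orbit_set_refl.
have AF : \bigcup_(i in I) F i `<=` A by move=> x [i _ []].
have mADU : measurable (A `\` \bigcup_(i in I) F i) by exact: measurableD.
have -> : mu A = mu (\bigcup_(i in I) F i).
  by rewrite (measureDI mu mA mU) setIidr// (proj1 (negligibleP mu mADU) negl) add0e.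
rewrite measure_bigcup//.
rewrite nneseries_esum//.
rewrite [X in \esum_(_ in X) _](_ : _ = I); last by apply/seteqP; split=> i /=; rewrite inE.
apply: eq_esum => i Ii.
by rewrite /mus/= /mrestr asboolT.
Qed.

(** The points that eventually fall into a periodic orbit form an invariant set.
    It is an increasing union of preimages of the orbit, so its measure is that
    of the orbit, which is positive and hence equal to one. *)
Theorem ergodic_orbit : ergodic_measure f mu ->
  exists2 p, S p & mu (orbit_set f p : set (borel M)) = 1%E.
Proof.
move=> erg.
have [I [p [mus [H _ sum]]]] := orbit_decomposition.
have [i Ii] : exists i, I i.
  apply: contrapT => /forallNP nI.
  have := sum setT measurableT; rewrite probability_setT.
  rewrite (_ : I = set0) ?esum_set0; last by apply/seteqP; split=> // i /nI.
  by move/eqP; rewrite onee_eq0.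
have [Sp m0 _] := H i Ii.
exists (p i) => //.
have [n n0 nx] := perS Sp.
pose O := orbit_set f (p i) : set (borel M).
have mO : measurable O := measurable_orbit Sp.
pose D k : set (borel M) := iter k f @^-1` O.
have mD k : measurable (D k).
  by rewrite -[X in measurable X]setTI; exact: measurable_fun_iter.
have DS k : D k `<=` D k.+1 by move=> x; exact: orbit_set_step.
have DD : f @^-1` (\bigcup_k D k) = \bigcup_k D k.
  apply/seteqP; split=> x [k _ Dk].
    by exists k.+1 => //; rewrite /D/= -iterS iterSr.
  by exists k => //; rewrite /D/= -iterSr; exact: DS.
have mDU : measurable (\bigcup_k D k) by exact: bigcup_measurable.
have ndD : {homo D : n m / (n <= m)%N >-> (n <= m)%O}.
  by apply/nondecreasing_seqP => k; apply/subsetPset; exact: DS.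
have cvgD := nondecreasing_cvg_mu (mu := mu) mD mDU ndD.
have muD k : mu (D k) = mu O by exact: (measure_iter mf mu_f).
have E : mu (\bigcup_k D k) = mu O.
  rewrite -(cvg_lim _ cvgD)//.
  rewrite (_ : mu \o D = cst (mu O)) ?lim_cst//.
  by apply/funext => k /=.
have [] := erg _ mDU DD; rewrite E// => O0.
have : (mu [set p i] <= mu O)%E.
  by apply: le_measure; rewrite ?inE// => x ->; exact: orbit_set_refl.
by rewrite O0 leNgt m0.
Qed.

End Decomposition.

(** * Strict differentiability *)

Section Calculus.
Context {R : realType}.

Lemma entry_le_norm {m n} (v : 'M[R]_(m, n)) i j : `|v i j| <= `|v|.
Proof.
rewrite (_ : `|v| = mx_norm v)// mx_normrE.
by apply: le_trans (le_bigmax _ _ (i, j)).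
Qed.

Lemma norm_le_entries {m n} (v : 'M[R]_(m, n)) (e : R) : 0 <= e ->
  (forall i j, `|v i j| <= e) -> `|v| <= e.
Proof.
move=> e0 H; rewrite (_ : `|v| = mx_norm v)// mx_normrE.
by apply/bigmax_leP; split => // -[i j] _ /=.
Qed.

Lemma is_derive_entry {n} (c : R -> 'rV[R]_n) t l : differentiable c t ->
  is_derive t 1 (fun s => c s 0 l) ('d c t 1 0 l).
Proof.
move=> dc.
have @f : {linear 'rV[R]_n -> R}.
  by exists (fun N : 'rV[R]_n => N 0 l); do 2![eexists]; do ?[constructor];
     rewrite ?mxE// => ? *; rewrite ?mxE//; move=> ?; rewrite !mxE.
have cf : continuous f by exact: matrix_normedtype.coord_continuous.
have df : differentiable f (c t) by exact: linear_differentiable.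
have dfc : differentiable (f \o c) t by exact: differentiable_comp.
have -> : (fun s => c s 0 l) = f \o c by [].
apply: DeriveDef; first exact: (diff_derivable dfc).
rewrite deriveE//.
by rewrite (diff_comp dc df)/= (diff_lin _ cf).
Qed.

Lemma differentiable_line {V W : normedModType R} (F : V -> W) (z w : V) (t : R) :
  differentiable F (z + t *: w) -> differentiable (fun s : R => F (z + s *: w)) t /\
  'd (fun s : R => F (z + s *: w)) t 1 = 'd F (z + t *: w) w.
Proof.
move=> dF.
have dl : is_diff t (fun s : R => z + s *: w) (fun s => s *: w).
  have -> : (fun s : R => s *: w) = 0 + (fun s => s *: w) by rewrite add0r.
  exact: is_diffD.
have dl' : differentiable (fun s : R => z + s *: w) t by exact: ex_diff.
split; first exact: (differentiable_comp dl').
rewrite (diff_comp (f := fun s : R => z + s *: w) dl' dF)/=.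
by rewrite (diff_val (is_diff_def := dl)) scale1r.
Qed.

Lemma mean_value_entry {n} {V : normedModType R} (F : V -> 'rV[R]_n) (z w : V) l :
  (forall t : R, 0 <= t <= 1 -> differentiable F (z + t *: w)) ->
  exists2 t : R, 0 <= t <= 1 & F (z + w) 0 l - F z 0 l = 'd F (z + t *: w) w 0 l.
Proof.
move=> dF; pose c t := F (z + t *: w).
have dc (t : R) : 0 <= t <= 1 -> differentiable c t by move=> /dF /differentiable_line[].
have [||t t01 E] := @MVT_segment R (fun s => c s 0 l) (fun s => 'd c s 1 0 l) 0 1 ler01.
- move=> t; rewrite in_itv/= => /andP[t0 t1]; apply: is_derive_entry.
  by apply: dc; rewrite !ltW.
- apply: derivable_within_continuous => t; rewrite in_itv/= => t01.
  by have [] := is_derive_entry l (dc t t01).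
rewrite in_itv/= in t01; exists t => //.
move: E; rewrite /c scale1r scale0r addr0 subr0 mulr1 => ->.
by have [_ ->] := differentiable_line (dF t t01).
Qed.

Lemma linear_bounded {n} {W : normedModType R} (A : {linear 'rV[R]_n -> W}) :
  exists2 K, 0 < K & forall v, `|A v| <= K * `|v|.
Proof.
exists (1 + \sum_j `|A (delta_mx 0 j)|).
  by rewrite ltr_pwDl// sumr_ge0.
move=> v; rewrite {1}(row_sum_delta v) linear_sum/=.
apply: (le_trans (ler_norm_sum _ _ _)).
apply: (@le_trans _ _ ((\sum_j `|A (delta_mx 0 j)|) * `|v|)).
  rewrite mulr_suml; apply: ler_sum => j _.
  by rewrite linearZ normrZ mulrC ler_wpM2l// entry_le_norm.
by rewrite ler_wpM2r// lerDr.
Qed.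

(** In finite dimension, closeness on the basis vectors bounds the operator
    norm; this is how continuity of the directional derivatives is used. *)
Lemma linear_dist_basis {n} {W : normedModType R} (A B : {linear 'rV[R]_n -> W}) e v :
  (forall j, `|A (delta_mx 0 j) - B (delta_mx 0 j)| <= e) ->
  `|A v - B v| <= n%:R * e * `|v|.
Proof.
move=> H.
have -> : A v - B v = \sum_j v 0 j *: (A (delta_mx 0 j) - B (delta_mx 0 j)).
  have expand (C : {linear 'rV[R]_n -> W}) : C v = \sum_j v 0 j *: C (delta_mx 0 j).
    by rewrite {1}(row_sum_delta v) linear_sum; apply: eq_bigr => j _; rewrite linearZ.
  by rewrite (expand A) (expand B) -sumrB; apply: eq_bigr => j _; rewrite scalerBr.
apply: (le_trans (ler_norm_sum _ _ _)).
apply: (@le_trans _ _ (\sum_(j < n) (`|v| * e))).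
  by apply: ler_sum => j _; rewrite normrZ ler_pM// entry_le_norm.
by rewrite sumr_const card_ord -[leLHS]mulr_natl (mulrC _ e) mulrA.
Qed.

Lemma linear_continuous_rV {n} {W : normedModType R} (A : {linear 'rV[R]_n -> W}) :
  continuous A.
Proof.
have [K K0 HK] := linear_bounded A.
apply: (@bounded_linear_continuous _ _ _ A); apply/linear_boundedP.
exists K; split=> [|r Kr x]; first by rewrite num_real.
apply: (le_trans (HK x)).
by rewrite ler_wpM2r// ltW.
Qed.

(** Strict differentiability (in the sense of Peano): the linear approximation
    holds for pairs of points near [x], not only for pairs that contain [x].
    In this form a derivative at the single point [x] composes along an orbit and
    yields Lipschitz constants near [x]. *)
Definition strict_deriv {V W : normedModType R} (F : V -> W) (x : V) (A : V -> W) :=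
  forall e : R, 0 < e -> exists2 r : R, 0 < r & forall y z, `|y - x| < r -> `|z - x| < r ->
    `|F y - F z - A (y - z)| <= e * `|y - z|.

Lemma strict_deriv_near {V W : normedModType R} (F G : V -> W) x A :
  (\forall y \near x, F y = G y) -> strict_deriv F x A -> strict_deriv G x A.
Proof.
move=> /nbhs_normP[s /= s0 FG] HF e e0; have [r r0 Hr] := HF e e0.
exists (Num.min r s); first by rewrite lt_min r0.
move=> y z; rewrite !lt_min => /andP[yr ys] /andP[zr zs].
by rewrite -!FG ?Hr//= distrC.
Qed.

Lemma strict_deriv_lipschitz {V W : normedModType R} (F : V -> W) x (A : V -> W) K e :
  0 < e -> (forall v, `|A v| <= K * `|v|) -> strict_deriv F x A ->
  exists2 r : R, 0 < r & forall y z, `|y - x| < r -> `|z - x| < r ->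
    `|F y - F z| <= (K + e) * `|y - z|.
Proof.
move=> e0 HK HF; have [r r0 Hr] := HF e e0; exists r => // y z yr zr.
have -> : F y - F z = (F y - F z - A (y - z)) + A (y - z) by rewrite subrK.
by rewrite (le_trans (ler_normD _ _))// mulrDl addrC lerD// Hr.
Qed.

Lemma strict_deriv_comp {n m k} (F : 'rV[R]_n -> 'rV[R]_m) (G : 'rV[R]_m -> 'rV[R]_k) x
  (A : {linear 'rV[R]_n -> 'rV[R]_m}) (B : {linear 'rV[R]_m -> 'rV[R]_k}) :
  strict_deriv F x A -> strict_deriv G (F x) B -> strict_deriv (G \o F) x (B \o A).
Proof.
move=> HF HG e e0.
have [K K0 HK] := linear_bounded A.
have [L L0 HL] := linear_bounded B.
have [r r0 Hr] := strict_deriv_lipschitz ltr01 HK HF.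
have e1 : 0 < e / 2 / (K + 1) by rewrite !divr_gt0// addr_gt0.
have [s s0 Hs] := HG _ e1.
have e2 : 0 < e / 2 / L by rewrite !divr_gt0.
have [t t0 Ht] := HF _ e2.
have K1 : 0 < K + 1 by rewrite addr_gt0.
exists (Num.min (Num.min r t) (s / (K + 1))); first by rewrite !lt_min r0 t0 divr_gt0.
move=> y z; rewrite !lt_min => /andP[/andP[yr yt] ys] /andP[/andP[zr zt] zs].
have xr : `|x - x| < r by rewrite subrr normr0.
have inb u : `|u - x| < r -> `|u - x| < s / (K + 1) -> `|F u - F x| < s.
  move=> ur; rewrite ltr_pdivlMr// mulrC => /(le_lt_trans _); apply.
  exact: Hr.
have -> : (G \o F) y - (G \o F) z - (B \o A) (y - z) =
   (G (F y) - G (F z) - B (F y - F z)) + B (F y - F z - A (y - z)).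
  by rewrite /= [B (_ - A _)]linearB/= addrA subrK.
apply: (le_trans (ler_normD _ _)).
have h1 := Hs _ _ (inb y yr ys) (inb z zr zs).
have h2 := Hr _ _ yr zr.
have h3 := le_trans (HL _) (ler_wpM2l (ltW L0) (Ht _ _ yt zt)).
have h4 := le_trans h1 (ler_wpM2l (ltW e1) h2).
apply: (le_trans (lerD h4 h3)).
rewrite (mulrA L) [L * (_ / L)]mulrC divfK ?gt_eqF//.
by rewrite mulrA divfK ?gt_eqF// -mulrDl -splitr.
Qed.

Lemma strict_deriv_diff {n} {W : normedModType R} (F : 'rV[R]_n -> W) x
  (A : {linear 'rV[R]_n -> W}) : strict_deriv F x A ->
  'd F x = A :> ('rV[R]_n -> W).
Proof.
move=> HF; apply: diff_unique; first exact: linear_continuous_rV.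
apply/eqaddoP => e e0; have [r r0 Hr] := HF e e0.
have : \forall h \near (0 : 'rV[R]_n), `|(F \o shift x - (cst (F x) + A)) h| <= e * `|h|; last by [].
apply/nbhs_norm0P; exists r => //= h hr.
have := Hr (h + x) x; rewrite !addrK subrr normr0 => /(_ hr r0).
by rewrite !fctE/= opprD addrA.
Qed.

(** The mean value theorem on segments, applied to each coordinate of [F]. *)
Lemma C1_strict_deriv {n m} (U : set 'rV[R]_n) (F : 'rV[R]_n -> 'rV[R]_m) (x : 'rV[R]_n) :
  nbhs x U -> Ck_on 1 U F -> strict_deriv F x ('d F x).
Proof.
move=> Ux [dF cF] e e0.
have Ux' := nbhs_singleton Ux.
have e1 : 0 < e / n.+1%:R by rewrite divr_gt0.
have near_diff : \forall p \near x, forall j : 'I_n,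
    `|'d F p (delta_mx 0 j) - 'd F x (delta_mx 0 j)| <= e / n.+1%:R.
  apply: (@filter_forall _ _ (fun (j : 'I_n) p => `|'d F p (delta_mx 0 j) - 'd F x (delta_mx 0 j)| <= e / n.+1%:R) (nbhs x)) => j.
  have /cvgrPdist_le/(_ _ e1) H := cF (delta_mx 0 j) x Ux'.
  apply: (filterS _ H) => p pH.
  rewrite distrC.
  exact: pH.
have : \forall p \near x, U p /\ forall j : 'I_n,
    `|'d F p (delta_mx 0 j) - 'd F x (delta_mx 0 j)| <= e / n.+1%:R.
  by apply: filterI Ux near_diff.
move=> /nbhs_normP[r r0 Hr].
exists r => // y z yr zr.
apply: norm_le_entries => [|i l]; first by rewrite mulr_ge0// ltW.
rewrite !ord1 !mxE.
have seg t : 0 <= t <= 1 -> `|(z + t *: (y - z)) - x| < r.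
  move=> /andP[t0 t1].
  have -> : z + t *: (y - z) - x = (1 - t) *: (z - x) + t *: (y - x).
    by apply/matrixP => a b; rewrite !mxE; ring.
  apply: (le_lt_trans (ler_normD _ _)); rewrite !normrZ !ger0_norm//; last by lra.
  have [->|tn0] := eqVneq t 0; first by rewrite subr0 mul1r mul0r addr0.
  have t00 : 0 < t by rewrite lt_neqAle eq_sym tn0.
  have : (1 - t) * `|z - x| <= (1 - t) * r by rewrite ler_wpM2l ?subr_ge0// ltW.
  have : t * `|y - x| < t * r by rewrite ltr_pM2l.
  lra.
have [t t01 E] : exists2 t : R, 0 <= t <= 1 &
    F y 0 l - F z 0 l = 'd F (z + t *: (y - z)) (y - z) 0 l.
  have [|t t01] := @mean_value_entry _ _ F z (y - z) l.
    by move=> t /seg tr; apply: dF; apply (Hr (z + t *: (y - z))); rewrite /= distrC.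
  by rewrite (addrC z) subrK => E; exists t.
rewrite E.
have [_ /= Hd] := Hr (z + t *: (y - z)) ltac:(by rewrite /= distrC; exact: seg).
have -> : 'd F (z + t *: (y - z)) (y - z) 0 l - 'd F x (y - z) 0 l =
   ('d F (z + t *: (y - z)) (y - z) - 'd F x (y - z)) 0 l by rewrite !mxE.
apply: (le_trans (entry_le_norm _ _ _)).
apply: (le_trans (linear_dist_basis _ Hd)).
rewrite ler_wpM2r// mulrA ler_pdivrMr// [leRHS]mulrC ler_wpM2r ?ler_nat//.
exact: ltW.
Qed.

End Calculus.

(** * Derivatives and norms in charts *)

Section Charts.
Context {R : realType} {d : nat} {M : topologicalType}.
Variables (X : smooth_manifold R d M) (g : riemannian_metric X).
Implicit Types (i j k : chart X) (x : M).

Definition rep (F : M -> M) i j : 'rV[R]_d -> 'rV[R]_d := coord j \o F \o param i.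

Lemma nbhs_dom i x : dom i x -> nbhs x (dom i).
Proof. by move=> ix; apply: open_nbhs_nbhs; split => //; exact: dom_open. Qed.

Lemma nbhs_codom i x : dom i x -> nbhs (coord i x) (coord i @` dom i).
Proof.
by move=> ix; apply: open_nbhs_nbhs; split; [exact: codom_open|exists x].
Qed.

Lemma paramK i y : (coord i @` dom i) y -> dom i (param i y) /\ coord i (param i y) = y.
Proof. by move=> [x ix <-]; rewrite coordK. Qed.

Lemma param_nbhs i x (V : set M) : dom i x -> nbhs x V ->
  \forall y \near coord i x, V (param i y) /\ (coord i @` dom i) y.
Proof.
move=> ix Vx; apply: filterI; last exact: nbhs_codom.
have := @param_continuous _ _ _ X i (coord i x) ltac:(by exists x).
by apply; rewrite coordK.
Qed.

(** The chart [k] in the middle cancels near [x], since [F] is continuous there. *)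
Lemma rep_comp (F G : M -> M) i j k x (A B : {linear 'rV[R]_d -> 'rV[R]_d}) :
  {for x, continuous F} -> dom i x -> dom k (F x) ->
  strict_deriv (rep F i k) (coord i x) A ->
  strict_deriv (rep G k j) (coord k (F x)) B ->
  strict_deriv (rep (G \o F) i j) (coord i x) (B \o A).
Proof.
move=> cF ix kFx HA HB.
apply: (@strict_deriv_near _ _ _ (rep G k j \o rep F i k)); last first.
  by apply: strict_deriv_comp HA _; rewrite /rep /= coordK.
have := param_nbhs ix (cF _ (nbhs_dom kFx)).
by apply: filterS => y [kFy _]; rewrite /rep /= coordK.
Qed.

Lemma strict_deriv_transition i j x : dom i x -> dom j x ->
  strict_deriv (coord j \o param i) (coord i x) ('d (coord j \o param i) (coord i x)).
Proof.
move=> ix jx; apply: C1_strict_deriv (transition_smooth i j 1).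
have := param_nbhs ix (nbhs_dom jx).
by apply: filterS => y [jy /paramK[iy E]]; exists (param i y).
Qed.

Lemma strict_deriv_rep (f : M -> M) i j x : C1_map X f -> dom i x -> dom j (f x) ->
  strict_deriv (rep f i j) (coord i x) ('d (rep f i j) (coord i x)).
Proof.
move=> [cf f1] ix jfx; apply: C1_strict_deriv (f1 i j).
have := param_nbhs ix (cf x _ (nbhs_dom jfx)).
by apply: filterS => y [jy /paramK[iy E]]; exists (param i y).
Qed.

Lemma strict_deriv_iter (f : M -> M) n i j x : C1_map X f -> dom i x ->
  dom j (iter n f x) ->
  exists A : {linear 'rV[R]_d -> 'rV[R]_d}, strict_deriv (rep (iter n f) i j) (coord i x) A.
Proof.
move=> f1; elim: n i j x => [|n IH] i j x ix jx.
  by exists ('d (coord j \o param i) (coord i x)); exact: strict_deriv_transition.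
pose k := chart_at X (iter n f x).
have kx : dom k (iter n f x) := dom_chart_at X _.
have [A HA] := IH i k x ix kx.
have HB := strict_deriv_rep f1 kx jx.
exists ('d (rep f k j) (coord k (iter n f x)) \o A).
exact: (rep_comp (continuous_iter f1.1 n x) ix kx HA HB).
Qed.

Lemma tangent_norm_ge0 i x v : 0 <= tangent_norm g i x v.
Proof. exact: sqrtr_ge0. Qed.

Lemma quadratic_scale (G : 'M[R]_d) (t : R) (v : 'rV[R]_d) :
  ((t *: v) *m G *m (t *: v)^T) 0 0 = t ^+ 2 * (v *m G *m v^T) 0 0.
Proof. by rewrite linearZ/= -!scalemxAl -scalemxAr scalerA mxE expr2. Qed.

Lemma tangent_norm_scale i x t v : 0 <= t ->
  tangent_norm g i x (t *: v) = t * tangent_norm g i x v.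
Proof.
move=> t0; rewrite /tangent_norm quadratic_scale sqrtrM ?sqr_ge0//.
by rewrite sqrtr_sqr ger0_norm.
Qed.

Lemma tangent_norm_transition i j x v : dom i x -> dom j x ->
  tangent_norm g j x ('d (coord j \o param i) (coord i x) v) = tangent_norm g i x v.
Proof. by move=> ix jx; rewrite /tangent_norm (metric_compat g ix jx). Qed.

Lemma quadratic_bound (G : 'M[R]_d) (v : 'rV[R]_d) :
  `|(v *m G *m v^T) 0 0| <= d%:R ^+ 2 * `|G| * `|v| ^+ 2.
Proof.
rewrite mxE (le_trans (ler_norm_sum _ _ _))//.
apply: (@le_trans _ _ (\sum_(j < d) (d%:R * `|G| * `|v| * `|v|))).
  apply: ler_sum => j _; rewrite normrM !mxE ler_pM ?entry_le_norm//.
  rewrite (le_trans (ler_norm_sum _ _ _))//.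
  apply: (@le_trans _ _ (\sum_(j < d) (`|v| * `|G|))).
    by apply: ler_sum => i _; rewrite normrM ler_pM// entry_le_norm.
  by rewrite sumr_const card_ord -[leLHS]mulr_natl (mulrC `|v|) mulrA.
by rewrite sumr_const card_ord -[leLHS]mulr_natl !expr2 !mulrA.
Qed.

Lemma quadratic_cvg {T : Type} (F : set_system T) {FF : Filter F}
    (G : T -> 'M[R]_d) (w : T -> 'rV[R]_d) (G0 : 'M[R]_d) (w0 : 'rV[R]_d) :
  G x @[x --> F] --> G0 -> w x @[x --> F] --> w0 ->
  (w x *m G x *m (w x)^T) 0 0 @[x --> F] --> (w0 *m G0 *m w0^T) 0 0.
Proof.
move=> cG cw.
have expand (A : 'M[R]_d) (u : 'rV[R]_d) :
    (u *m A *m u^T) 0 0 = \sum_j (\sum_i u 0 i * A i j) * u 0 j.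
  by rewrite mxE; apply: eq_bigr => j _; rewrite !mxE.
rewrite expand; under eq_cvg do rewrite expand.
have addc : continuous (fun z : R * R => z.1 + z.2) by exact: add_continuous.
have cGe (i j : 'I_d) : G x i j @[x --> F] --> G0 i j.
  exact: (@cvg_comp _ _ _ G (fun A : 'M[R]_d => A i j) F (nbhs G0) (nbhs (G0 i j)) cG
    (@matrix_normedtype.coord_continuous R d d i j G0)).
have cwe (i : 'I_d) : w x 0 i @[x --> F] --> w0 0 i.
  exact: (@cvg_comp _ _ _ w (fun u : 'rV[R]_d => u 0 i) F (nbhs w0) (nbhs (w0 0 i)) cw
    (@matrix_normedtype.coord_continuous R 1 d 0 i w0)).
apply: (@cvg_big R 'I_d +%R 0 xpredT addc T F) => j _.
apply: cvgM; last exact: cwe.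
apply: (@cvg_big R 'I_d +%R 0 xpredT addc T F) => i _.
by apply: cvgM.
Qed.

(** The minimum on the compact unit sphere is positive. *)
Lemma quadratic_coercive (G : 'M[R]_d) :
  (forall v : 'rV[R]_d, v != 0 -> 0 < (v *m G *m v^T) 0 0) ->
  exists2 c : R, 0 < c & forall v : 'rV[R]_d, c * `|v| ^+ 2 <= (v *m G *m v^T) 0 0.
Proof.
move=> pos; pose S := [set v : 'rV[R]_d | `|v| = 1].
have unit_case c : 0 < c -> (forall v, S v -> c <= (v *m G *m v^T) 0 0) ->
    exists2 c : R, 0 < c & forall v : 'rV[R]_d, c * `|v| ^+ 2 <= (v *m G *m v^T) 0 0.
  move=> c0 H; exists c => // v; have [->|v0] := eqVneq v 0.
    by rewrite normr0 expr0n/= mulr0 !mul0mx mxE.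
  have nv : 0 < `|v| by rewrite normr_gt0.
  have : S (`|v|^-1 *: v) by rewrite /S/= normrZ normfV normr_id mulVf ?gt_eqF.
  move=> /H; rewrite quadratic_scale exprVn mulrC ler_pdivlMr ?exprn_gt0//.
have cS : compact S.
  apply: bounded_closed_compact.
    exists 1; split; first by rewrite num_real.
    by move=> r r1 v /= ->; exact: ltW.
  rewrite (_ : S = (fun v => `|v|) @^-1` [set 1])//.
  apply: preimage_closed; first by move=> v _; exact: norm_continuous.
  by rewrite (_ : [set 1] = [set x | x = 1])//; exact: closed_eq.
have [S0|/set0P S0] := eqVneq S set0.
  by apply: (unit_case 1) => // v; rewrite S0.
have [|c Sc Hc] := @EVT_min_rV R d (fun v => (v *m G *m v^T) 0 0) S S0 cS.
  apply: continuous_subspaceT => v.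
  exact: (@quadratic_cvg _ (nbhs v) _ (cst G) id G v (cvg_cst G) cvg_id).
apply: (unit_case ((c *m G *m c^T) 0 0)); last by move=> v /mem_set/Hc.
by apply: pos; apply/eqP => c0; move: Sc; rewrite inE /S c0/= normr0 => /eqP; rewrite eq_sym oner_eq0.
Qed.

(** The Gram matrix is coercive at [x], and a perturbation of size [e] changes the
    quadratic form by at most half the coercivity constant. *)
Lemma tangent_norm_bounds i x : dom i x ->
  exists2 C : R, 0 < C & \forall y \near x, forall v,
    `|v| <= C * tangent_norm g i y v /\ tangent_norm g i y v <= C * `|v|.
Proof.
move=> ix; have cx : (coord i @` dom i) (coord i x) by exists x.
pose G y := metric g i (coord i y).
have [c c0 Hc] := quadratic_coercive (metric_pos g cx).
pose D : R := d%:R ^+ 2.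
have D0 : 0 <= D by rewrite exprn_ge0.
have D1 : 0 < D + 1 by lra.
pose e := c / 2 / (D + 1).
have e0 : 0 < e by rewrite !divr_gt0.
have De : D * e <= c / 2.
  have -> : c / 2 = e * (D + 1) by rewrite /e divfK ?gt_eqF.
  by rewrite mulrDr mulr1 mulrC lerDl ltW.
pose K := D * `|G x| + c / 2.
have c20 : 0 < c / 2 by rewrite divr_gt0.
have K0 : 0 <= K by rewrite addr_ge0 ?(ltW c20)// mulr_ge0.
have sc : 0 < Num.sqrt (c / 2) by rewrite sqrtr_gt0.
exists ((Num.sqrt (c / 2))^-1 + Num.sqrt K).
  by rewrite ltr_pwDl// ?invr_gt0// sqrtr_ge0.
have cG : G y @[y --> x] --> G x.
  apply: (@continuous_comp _ _ _ (coord i) (metric g i) x).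
    exact: coord_continuous.
  exact: (@metric_smooth _ _ _ _ g i 0%N _ cx).
move/cvgrPdist_le : cG => /(_ _ e0).
apply: filterS => y Gy v.
have diff : `|(v *m G y *m v^T) 0 0 - (v *m G x *m v^T) 0 0| <= c / 2 * `|v| ^+ 2.
  have -> : (v *m G y *m v^T) 0 0 - (v *m G x *m v^T) 0 0 = (v *m (G y - G x) *m v^T) 0 0.
    by rewrite mulmxBr mulmxBl !mxE.
  apply: (le_trans (quadratic_bound _ _)); rewrite ler_wpM2r ?exprn_ge0//.
  by apply: le_trans De; rewrite ler_wpM2l// distrC.
have Qlow : c / 2 * `|v| ^+ 2 <= (v *m G y *m v^T) 0 0.
  have := Hc v; move: diff; rewrite ler_norml -/(G x).
  by move: ((v *m G y *m v^T) 0 0) ((v *m G x *m v^T) 0 0) (`|v| ^+ 2) => p q r /andP[]; lra.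
have Qup : (v *m G y *m v^T) 0 0 <= K * `|v| ^+ 2.
  have := quadratic_bound (G x) v; move: diff.
  rewrite !ler_norml /K mulrDl -/D.
  move: ((v *m G y *m v^T) 0 0) ((v *m G x *m v^T) 0 0) (`|v| ^+ 2) => p q r.
  by move=> /andP[_ ?] /andP[_ ?]; lra.
have sq w : Num.sqrt (w * `|v| ^+ 2) = Num.sqrt w * `|v|.
  by rewrite mulrC sqrtrM ?exprn_ge0// sqrtr_sqr normr_id mulrC.
have low : Num.sqrt (c / 2) * `|v| <= tangent_norm g i y v.
  by rewrite -sq ler_wsqrtr.
have up : tangent_norm g i y v <= Num.sqrt K * `|v| by rewrite -sq ler_wsqrtr.
have tn0 := tangent_norm_ge0 i y v.
rewrite !mulrDl; split.
  rewrite ler_wpDr ?mulr_ge0 ?sqrtr_ge0//.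
  by rewrite -ler_pdivrMl ?invr_gt0// invrK.
by rewrite ler_wpDl// mulr_ge0// invr_ge0 ltW.
Qed.

Lemma tangent_norm_eq0 i x v : dom i x -> tangent_norm g i x v = 0 -> v = 0.
Proof.
move=> ix tv; have [C _ /nbhs_singleton/(_ v)[]] := tangent_norm_bounds ix.
by rewrite tv mulr0 normr_le0 => /eqP.
Qed.

(** The supremum that defines the operator norm is over a nonempty bounded set,
    because the tangent norms are comparable to the coordinate norm; vectors of
    norm zero are zero. *)
Lemma opnorm_bound (F : M -> M) x v : {for x, continuous F} ->
  tangent_norm g (chart_at X (F x)) (F x) (tangent_map X F x v) <=
  opnorm_tangent g F x * tangent_norm g (chart_at X x) x v.
Proof.
move=> cF; set i := chart_at X x; set j := chart_at X (F x).
have ix : dom i x := dom_chart_at X x.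
have jFx : dom j (F x) := dom_chart_at X (F x).
pose T := tangent_map X F x.
have T_lin : {T' : {linear 'rV[R]_d -> 'rV[R]_d} | T = T'}.
  by exists ('d (coord j \o F \o param i) (coord i x)).
have [T' TE] := T_lin.
(* Normalizing [v] requires a nonzero norm. *)
have [t0|tn0] := eqVneq (tangent_norm g i x v) 0.
  rewrite t0 mulr0 -/T TE (tangent_norm_eq0 ix t0) linear0 /tangent_norm.
  by rewrite !mul0mx mxE sqrtr0.
have t_gt0 : 0 < tangent_norm g i x v by rewrite lt_neqAle eq_sym tn0 tangent_norm_ge0.
set t := tangent_norm g i x v in t_gt0 *.
rewrite -ler_pdivrMr// mulrC -tangent_norm_scale ?invr_ge0 ?(ltW t_gt0)//.
have -> : t^-1 *: tangent_map X F x v = T (t^-1 *: v) by rewrite TE linearZ/= -TE.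
apply: ub_le_sup; last first.
  exists (t^-1 *: v) => //=; rewrite tangent_norm_scale ?invr_ge0 ?(ltW t_gt0)//.
  by rewrite -/t mulVf ?gt_eqF.
have [C C0 /nbhs_singleton HC] := tangent_norm_bounds ix.
have [C' C'0 /nbhs_singleton HC'] := tangent_norm_bounds jFx.
have [K K0 HK] := linear_bounded T'.
exists (C' * (K * C)) => _ [w /= w1 <-].
rewrite -/T TE; apply: (le_trans (HC' _).2); rewrite ler_wpM2l ?(ltW C'0)//.
apply: (le_trans (HK _)); rewrite ler_wpM2l ?(ltW K0)//.
by apply: (le_trans (HC _).1); rewrite ler_piMr// ltW.
Qed.

Lemma strict_deriv_unique {n} {W : normedModType R} (F : 'rV[R]_n -> W) (a : 'rV[R]_n)
  (A B : {linear 'rV[R]_n -> W}) : strict_deriv F a A -> strict_deriv F a B ->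
  A = B :> ('rV[R]_n -> W).
Proof. by move=> /strict_deriv_diff <- /strict_deriv_diff <-. Qed.

Lemma transition_inverse i j x v : dom i x -> dom j x ->
  'd (coord i \o param j) (coord j x) ('d (coord j \o param i) (coord i x) v) = v.
Proof.
move=> ix jx.
have H := @rep_comp id id i i j x _ _ (@cvg_id _ _) ix jx
  (strict_deriv_transition ix jx) (strict_deriv_transition jx ix).
have Hid : strict_deriv (rep (id \o id) i i) (coord i x) (@idfun 'rV[R]_d).
  apply: (@strict_deriv_near _ _ _ id); last first.
    by move=> e e0; exists 1 => // y z _ _; rewrite subrr normr0 mulr_ge0// ltW.
  by apply: filterS (nbhs_codom ix) => y /paramK[_ E]; rewrite /rep/= E.
by have := strict_deriv_unique H Hid => /(congr1 (fun h => h v)).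
Qed.

(** The operator norm is defined with selected charts; conjugating by the chart
    transitions, which preserve tangent norms, gives the bound in any charts. *)
Lemma strict_deriv_norm (F : M -> M) i j x (A : {linear 'rV[R]_d -> 'rV[R]_d}) v :
  {for x, continuous F} -> dom i x -> dom j (F x) ->
  strict_deriv (rep F i j) (coord i x) A ->
  tangent_norm g j (F x) (A v) <= opnorm_tangent g F x * tangent_norm g i x v.
Proof.
move=> cF ix jFx HA.
set k := chart_at X x; set l := chart_at X (F x).
have kx : dom k x := dom_chart_at X x.
have lFx : dom l (F x) := dom_chart_at X (F x).
have H1 := @rep_comp id F k j i x _ _ (@cvg_id _ _) kx ix (strict_deriv_transition kx ix) HA.
have H2 : strict_deriv (rep F k l) (coord k x)
    (('d (coord l \o param j) (coord j (F x)) \o (A \o 'd (coord i \o param k) (coord k x)))).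
  exact: (@rep_comp F id k l j x _ _ cF kx jFx H1 (strict_deriv_transition jFx lFx)).
have E := strict_deriv_diff H2.
have Ew w : tangent_map X F x w = 'd (coord l \o param j) (coord j (F x))
    (A ('d (coord i \o param k) (coord k x) w)).
  by have := congr1 (fun h : 'rV[R]_d -> 'rV[R]_d => h w) E; apply.
(* [v] is transported to the selected chart at [x]. *)
have [w wn wi] : exists2 w, tangent_norm g k x w = tangent_norm g i x v &
    'd (coord i \o param k) (coord k x) w = v.
  exists ('d (coord k \o param i) (coord i x) v).
    exact: tangent_norm_transition.
  exact: transition_inverse.
have Tw : tangent_norm g l (F x) (tangent_map X F x w) = tangent_norm g j (F x) (A v).
  apply: (etrans _ (tangent_norm_transition (A v) jFx lFx)).
  exact: (congr1 (tangent_norm g l (F x)) (etrans (Ew w) (congr1 (fun u => _ (A u)) wi))).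
by rewrite -Tw -wn; exact: opnorm_bound.
Qed.

End Charts.

(** * A metric from truncated coordinates *)

Section Embedding.
Context {R : realType} {d : nat} {M : ptopologicalType}.
Variables (X : smooth_manifold R d M) (g : riemannian_metric X).
Hypothesis hM : hausdorff_space M.
Hypothesis cM : compact [set: M].

Record coord_ball := CoordBall {
  cb_chart : chart X;
  cb_center : 'rV[R]_d;
  cb_radius : R;
  cb_sub : [set v | `|v - cb_center| <= cb_radius] `<=` coord cb_chart @` dom cb_chart
}.

(** Lipschitz rather than smooth: distances are compared through local Lipschitz
    bounds of [bump] and [bump_coord]. *)
Definition bump (c : coord_ball) (y : M) : R :=
  if `[< dom (cb_chart c) y >]
  then Num.max 0 (cb_radius c - `|coord (cb_chart c) y - cb_center c|) else 0.

Definition bump_coord (c : coord_ball) (y : M) : 'rV[R]_d :=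
  bump c y *: coord (cb_chart c) y.

Lemma bump_ge0 c y : 0 <= bump c y.
Proof. by rewrite /bump; case: asboolP => // _; rewrite le_max lexx. Qed.

Lemma bump_gt0 c y : 0 < bump c y ->
  dom (cb_chart c) y /\ `|coord (cb_chart c) y - cb_center c| <= cb_radius c.
Proof.
rewrite /bump; case: asboolP => [ky|]; last by rewrite ltxx.
by rewrite lt_max ltxx/= subr_gt0 => /ltW.
Qed.

Lemma bump_le c y : bump c y <= Num.max 0 (cb_radius c).
Proof.
rewrite /bump; case: asboolP => _; last by rewrite le_max lexx.
by rewrite ge_max !le_max lexx/= gerBl normr_ge0 orbT.
Qed.

Lemma bump_lipschitz_in c y z : dom (cb_chart c) y -> dom (cb_chart c) z ->
  `|bump c y - bump c z| <= `|coord (cb_chart c) y - coord (cb_chart c) z|.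
Proof.
move=> ky kz; rewrite /bump !asboolT//.
set a := cb_center c; set u := coord _ y; set v := coord _ z; set r := cb_radius c.
have : `| (`|u - a| - `|v - a|) | <= `|u - v|.
  have -> : u - v = (u - a) - (v - a) by rewrite opprB addrA subrK.
  exact: ler_dist_dist.
move: `|u - a| `|v - a| `|u - v| => p q w.
rewrite !ler_norml => /andP[h1 h2].
by case: (ltP 0 (r - p)) => ?; case: (ltP 0 (r - q)) => ?; apply/andP; split; lra.
Qed.

(** Compact in a Hausdorff space. This is what makes a bump vanish near every point
    outside its chart. *)
Lemma support_closed c :
  closed (param (cb_chart c) @` [set v | `|v - cb_center c| <= cb_radius c]).
Proof.
apply: compact_closed => //; apply: continuous_compact.
  apply: continuous_in_subspaceT => v; rewrite inE => /cb_sub.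
  exact: param_continuous.
apply: bounded_closed_compact.
  exists (cb_radius c + `|cb_center c|); split; first by rewrite num_real.
  move=> r rr v /= vr; apply: le_trans (ltW rr).
  by rewrite -[v in leLHS](subrK (cb_center c)) (le_trans (ler_normD _ _))// lerD2r.
rewrite (_ : [set v | _] = (fun v => `|v - cb_center c|) @^-1` [set t | t <= cb_radius c])//.
apply: preimage_closed; last exact: closed_le.
move=> v _.
have cv : u - cb_center c @[u --> v] --> v - cb_center c.
  exact: (@cvgB _ _ _ (nbhs v) _ id (cst (cb_center c)) v (cb_center c) cvg_id (cvg_cst _)).
exact: (cvg_norm cv).
Qed.

Definition lipschitz_in_chart {V : normedModType R} (h : M -> V) (j : chart X) (y0 : M) :=
  exists C : R, 0 <= C /\ exists2 V, nbhs y0 V & forall y z, V y -> V z ->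
    `|h y - h z| <= C * `|coord j y - coord j z|.

Lemma bump_lipschitz c j y0 : dom j y0 ->
  lipschitz_in_chart (bump c) j y0 /\ lipschitz_in_chart (bump_coord c) j y0.
Proof.
move=> jy0; set k := cb_chart c.
have [ky0|nky0] := pselect (dom k y0); last first.
  have out : nbhs y0 (~` (param k @` [set v | `|v - cb_center c| <= cb_radius c])).
    apply: open_nbhs_nbhs; split; first by rewrite openC; exact: support_closed.
    by move=> [v /cb_sub/paramK[+ _] E]; rewrite E.
  have zero y : (~` (param k @` [set v | `|v - cb_center c| <= cb_radius c])) y -> bump c y = 0.
    move=> ny; apply/le_anti; rewrite bump_ge0 andbT leNgt; apply/negP => /bump_gt0[ky yr].
    by apply: ny; exists (coord k y) => //; exact: coordK.
  split; exists 0; split => //; eexists; try exact: out;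
    by move=> y z /zero y0' /zero z0'; rewrite /bump_coord y0' z0' ?scale0r subrr normr0 mul0r.
have [K K0 HK] := linear_bounded ('d (coord k \o param j) (coord j y0)).
have [s s0 Hs] := strict_deriv_lipschitz ltr01 HK (strict_deriv_transition jy0 ky0).
pose L := K + 1; have L0 : 0 <= L by rewrite addr_ge0 ?(ltW K0).
pose V := [set y | [/\ dom j y, dom k y, `|coord j y - coord j y0| < s &
                   `|coord k y - coord k y0| < 1]].
have nV : nbhs y0 V.
  have n1 := nbhs_dom jy0; have n2 := nbhs_dom ky0.
  have /cvgrPdist_lt/(_ _ s0) n3 := coord_continuous jy0.
  have /cvgrPdist_lt/(_ _ ltr01) n4 := coord_continuous ky0.
  apply: filterS (filterI (filterI n1 n2) (filterI n3 n4)) => y [[h1 h2] [h3 h4]].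
  by split => //; rewrite distrC.
have lipk y z : V y -> V z -> `|coord k y - coord k z| <= L * `|coord j y - coord j z|.
  move=> [jy ky ys _] [jz kz zs _].
  by have := Hs _ _ ys zs; rewrite /= !coordK.
split.
  exists L; split => //; exists V => // y z Vy Vz; apply: le_trans (lipk y z Vy Vz).
  by case: Vy Vz => _ ky _ _ [_ kz _ _]; exact: bump_lipschitz_in.
pose B := `|coord k y0| + 1 + Num.max 0 (cb_radius c).
have m0 : 0 <= Num.max 0 (cb_radius c) by rewrite le_max lexx.
have B0 : 0 <= B by rewrite !addr_ge0.
exists (B * L); split; first exact: mulr_ge0.
exists V => // y z Vy Vz; have kl := lipk y z Vy Vz.
case: (Vy) (Vz) => _ ky _ yk [_ kz _ zk].
have -> : bump_coord c y - bump_coord c z =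
    (bump c y - bump c z) *: coord k y + bump c z *: (coord k y - coord k z).
  by rewrite /bump_coord -/k scalerBl scalerBr addrA subrK.
apply: (le_trans (ler_normD _ _)); rewrite !normrZ.
have yb : `|coord k y| <= `|coord k y0| + 1.
  rewrite -[coord k y in leLHS](subrK (coord k y0)) (le_trans (ler_normD _ _))//.
  by rewrite addrC lerD2l ltW.
have h1 : `|bump c y - bump c z| * `|coord k y| <=
    `|coord k y - coord k z| * (`|coord k y0| + 1).
  by rewrite ler_pM// bump_lipschitz_in.
have h2 : `|bump c z| * `|coord k y - coord k z| <=
    `|coord k y - coord k z| * Num.max 0 (cb_radius c).
  by rewrite mulrC ler_wpM2l// ger0_norm ?bump_ge0// bump_le.
apply: (le_trans (lerD h1 h2)); rewrite -mulrDr mulrC -mulrA.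
by rewrite ler_wpM2l.
Qed.

(** The distance between the images of [y] and [z] in a Euclidean space under the
    map whose components are all bumps and truncated coordinates. *)
Definition bump_dist (s : seq coord_ball) (y z : M) : R :=
  \sum_(c <- s) (`|bump c y - bump c z| + `|bump_coord c y - bump_coord c z|).

Lemma bump_dist_ge0 s y z : 0 <= bump_dist s y z.
Proof. by apply: sumr_ge0 => c _; rewrite addr_ge0. Qed.

Lemma bump_dist_ge (s : seq coord_ball) c y z : List.In c s ->
  `|bump c y - bump c z| <= bump_dist s y z /\
  `|bump_coord c y - bump_coord c z| <= bump_dist s y z.
Proof.
elim: s => [//|b s IH]; rewrite /bump_dist big_cons -/(bump_dist s y z) /=.
have D0 := bump_dist_ge0 s y z.
case=> [->|/IH[]]; have := normr_ge0 (bump c y - bump c z);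
have := normr_ge0 (bump_coord c y - bump_coord c z);
have := normr_ge0 (bump b y - bump b z);
have := normr_ge0 (bump_coord b y - bump_coord b z); lra.
Qed.

Lemma bump_dist_le_chart s (j : chart X) y0 : dom j y0 ->
  exists C : R, 0 <= C /\ exists2 V, nbhs y0 V & forall y z, V y -> V z ->
    bump_dist s y z <= C * `|coord j y - coord j z|.
Proof.
move=> jy0; elim: s => [|c s [C [C0 [V nV HV]]]].
  by exists 0; split => //; exists setT; [exact: filterT|move=> y z _ _; rewrite /bump_dist big_nil mul0r].
have [[C1 [C10 [V1 nV1 H1]]] [C2 [C20 [V2 nV2 H2]]]] := bump_lipschitz c jy0.
exists (C1 + C2 + C); split; first by rewrite !addr_ge0.
exists (V `&` (V1 `&` V2)); first by apply: filterI => //; exact: filterI.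
move=> y z [Vy [V1y V2y]] [Vz [V1z V2z]].
by rewrite /bump_dist big_cons !mulrDl !lerD ?H1 ?H2 ?HV.
Qed.

(** Where a bump is positive, the coordinates are the quotient of [bump_coord] by
    [bump], hence Lipschitz functions of the components of the embedding. *)
Lemma chart_le_bump_dist (s : seq coord_ball) c y0 : List.In c s -> 0 < bump c y0 ->
  exists2 r : R, 0 < r & exists2 C : R, 0 <= C &
    forall y z, bump_dist s y0 y < r -> bump_dist s y0 z < r ->
      [/\ dom (cb_chart c) y, dom (cb_chart c) z &
       `|coord (cb_chart c) y - coord (cb_chart c) z| <= C * bump_dist s y z].
Proof.
move=> cs; set h := bump c y0 => h0; set k := cb_chart c.
pose B := `|cb_center c| + `|cb_radius c|.
have B0 : 0 <= B by rewrite addr_ge0.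
exists (h / 2); first by rewrite divr_gt0.
exists (2 / h * (1 + B)); first by rewrite mulr_ge0 ?divr_ge0 ?addr_ge0 ?(ltW h0).
have big y : bump_dist s y0 y < h / 2 -> h / 2 < bump c y.
  have [+ _] := @bump_dist_ge s c y0 y cs.
  by rewrite -/h ler_norml => /andP[]; lra.
have norm_coord y : 0 < bump c y -> `|coord k y| <= B.
  move=> /bump_gt0[_ yr].
  rewrite -[coord k y in leLHS](subrK (cb_center c)) addrC.
  by rewrite (le_trans (ler_normD _ _))// lerD2l (le_trans yr)// ler_norm.
have pos y : bump_dist s y0 y < h / 2 -> 0 < bump c y.
  by move=> /big; apply: lt_trans; rewrite divr_gt0.
move=> y z yr zr; have [ky _] := bump_gt0 (pos y yr); have [kz _] := bump_gt0 (pos z zr).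
split => //.
have [d1 d2] := @bump_dist_ge s c y z cs.
set D := bump_dist s y z in d1 d2 *.
(* The difference of the quotients, with the denominator cleared. *)
have E : bump c y *: (coord k y - coord k z) =
   (bump_coord c y - bump_coord c z) - (bump c y - bump c z) *: coord k z.
  by rewrite /bump_coord -/k scalerBr scalerBl opprB addrA subrK.
have le1 : bump c y * `|coord k y - coord k z| <= D * (1 + B).
  rewrite -[X in X * _](ger0_norm (bump_ge0 c y)) -normrZ E.
  rewrite (le_trans (ler_normB _ _))// normrZ mulrDr mulr1 lerD//.
  by rewrite ler_pM// norm_coord// pos.
have le2 : h / 2 * `|coord k y - coord k z| <= D * (1 + B).
  by apply: le_trans le1; rewrite ler_wpM2r// ltW// big.
have h2 : 0 < h / 2 by rewrite divr_gt0.
rewrite -(ler_pM2l h2) (le_trans le2)//.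
have -> : h / 2 * (2 / h * (1 + B) * D) = D * (1 + B) by field; rewrite gt_eqF.
by [].
Qed.

Lemma bump_cover : exists s : seq coord_ball,
  forall y, exists2 c, List.In c s & 0 < bump c y.
Proof.
have ball_at x : {c : coord_ball | cb_chart c = chart_at X x /\
    cb_center c = coord (chart_at X x) x /\ 0 < cb_radius c}.
  apply: cid; set k := chart_at X x.
  have /nbhs_normP[r /= r0 Hr] := nbhs_codom (dom_chart_at X x).
  have sub : [set v | `|v - coord k x| <= r / 2] `<=` coord k @` dom k.
    by move=> v /= vr; apply: Hr; rewrite /= distrC (le_lt_trans vr)//; lra.
  by exists (CoordBall sub); rewrite /= divr_gt0.
pose c x := sval (ball_at x).
have cx x : nbhs x [set y | 0 < bump (c x) y].
  have [kE [aE r0]] := svalP (ball_at x); rewrite -/(c x) in kE aE r0.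
  have kx : dom (cb_chart (c x)) x by rewrite kE; exact: dom_chart_at.
  have /cvgrPdist_lt/(_ _ r0) n1 := coord_continuous kx.
  apply: filterS (filterI (nbhs_dom kx) n1) => y [ky yr].
  rewrite /bump /= asboolT// lt_max ltxx/= subr_gt0 aE distrC -kE; exact: yr.
move: cM; rewrite compact_cover => cM'.
have [] := cM' M [set: M] (fun x => interior [set y | 0 < bump (c x) y]).
- by move=> x _; exact: open_interior.
- by move=> y _; exists y => //; exact: cx.
move=> D _ MD; exists (map c (finmap.enum_fset D)) => y.
have [x xD yx] := MD y I; exists (c x); last exact: interior_subset yx.
have : x \in (finmap.enum_fset D : seq M) by exact: xD.
move: (finmap.enum_fset D) => l xl; apply: List.in_map.
elim: l xl => [//|a l IH].
by rewrite inE => /orP[/eqP->|/IH]; [left|right].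
Qed.

Lemma bump_dist_metric (s : seq coord_ball) :
  (forall y, exists2 c, List.In c s & 0 < bump c y) -> topology_metric (bump_dist s).
Proof.
move=> cov.
have xx x : bump_dist s x x = 0.
  by apply: big1 => c _; rewrite !subrr !normr0 addr0.
split => //.
- move=> x y; rewrite /bump_dist; apply: eq_bigr => c _.
  by congr (_ + _); exact: distrC.
- move=> x y z; rewrite /bump_dist -big_split; apply: ler_sum => c _ /=.
  rewrite addrACA; by apply: lerD; exact: ler_distD.
- move=> x y xy; have [c cs c0] := cov x.
  have [r r0 [C _ H]] := chart_le_bump_dist cs c0.
  have [||kx ky] := H x y; rewrite ?xx ?xy// mulr0 normr_le0 subr_eq0 => /eqP E.
  by rewrite -(coordK kx) E coordK.
- move=> x r r0; have kx := dom_chart_at X x; set k := chart_at X x in kx.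
  have [C [C0 [V nV HV]]] := bump_dist_le_chart s kx.
  have e0 : 0 < r / (C + 1) by rewrite divr_gt0//; lra.
  have /cvgrPdist_lt/(_ _ e0) n1 := coord_continuous kx.
  apply: filterS (filterI nV n1) => y [Vy yr].
  apply: (le_lt_trans (HV x y (nbhs_singleton nV) Vy)).
  have C1 : 0 < C + 1 by lra.
  move: yr; rewrite ltr_pdivlMr// mulrC; apply: le_lt_trans.
  by rewrite ler_wpM2r// lerDl.
- move=> x V nV; have [c cs c0] := cov x.
  have [kx _] := bump_gt0 c0; set k := cb_chart c in kx.
  have [r r0 [C C0 H]] := chart_le_bump_dist cs c0.
  have /nbhs_normP[e /= e0 He] := param_nbhs kx nV.
  have C1 : 0 < C + 1 by lra.
  exists (Num.min r (e / (C + 1))); first by rewrite lt_min r0 divr_gt0.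
  move=> y /=; rewrite lt_min => /andP[yr ye].
  have [|_ ky xy] := H x y _ yr; first by rewrite xx.
  have [] := He (coord k y); last by rewrite coordK.
  rewrite /=; apply: (le_lt_trans xy); move: ye; rewrite ltr_pdivlMr// mulrC.
  by apply: le_lt_trans; rewrite ler_wpM2r ?bump_dist_ge0// lerDl.
Qed.

End Embedding.

(** * Uniform charts and Lipschitz constants of the iterates *)

Section GoodCharts.
Context {R : realType} {d : nat} {M : ptopologicalType}.
Variables (X : smooth_manifold R d M) (g : riemannian_metric X).
Hypothesis hM : hausdorff_space M.
Hypothesis cM : compact [set: M].

(** A chart domain on which coordinate distance and [rho], and coordinate norm and
    tangent norm, are comparable with the constant [C]. Having the same [C] at
    all points is essential: the endpoint of an iterate ranges over [M]. *)
Record good_chart (rho : M -> M -> R) (C : R) (k : chart X) (V : set M) : Prop := GoodChart {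
  gc_open : open V;
  gc_dom : V `<=` dom k;
  gc_norm : forall y v, V y ->
    `|v| <= C * tangent_norm g k y v /\ tangent_norm g k y v <= C * `|v|;
  gc_dist : forall y z, V y -> V z ->
    `|coord k y - coord k z| <= C * rho y z /\ rho y z <= C * `|coord k y - coord k z|
}.

Lemma good_chartW rho C C' k V : topology_metric rho -> C <= C' ->
  good_chart rho C k V -> good_chart rho C' k V.
Proof.
move=> hrho CC [oV Vk Vn Vd]; split => // [y v Vy|y z Vy Vz].
  have [h1 h2] := Vn y v Vy; split.
    by apply: (le_trans h1); rewrite ler_wpM2r// tangent_norm_ge0.
  by apply: (le_trans h2); rewrite ler_wpM2r.
have [h1 h2] := Vd y z Vy Vz; split.
  by apply: (le_trans h1); rewrite ler_wpM2r// (rho_ge0 hrho).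
by apply: (le_trans h2); rewrite ler_wpM2r.
Qed.

Lemma compact_uniform (P : R -> M -> Prop) :
  (forall C C' x, C <= C' -> P C x -> P C' x) ->
  (forall x : M, exists C, \forall y \near x, P C y) -> exists2 C, 0 < C & forall x, P C x.
Proof.
move=> mono loc; have [c cP] := choice loc.
move: (cM); rewrite compact_cover => cM'.
have [] := cM' M [set: M] (fun x => interior [set y | P (c x) y]).
- by move=> x _; exact: open_interior.
- by move=> y _; exists y => //; exact: cP.
move=> D _ MD.
have [C C0 HC] : exists2 C, 0 < C & forall x, x \in (finmap.enum_fset D : seq M) -> c x <= C.
  elim: (finmap.enum_fset D) => [|a l [C C0 HC]]; first by exists 1.
  exists (Num.max C (c a)); first by rewrite lt_max C0.
  by move=> x; rewrite inE le_max => /orP[/eqP->|/HC ->//]; rewrite lexx orbT.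
exists C => // x; have [y yD xy] := MD x I.
exact: mono (HC y yD) (interior_subset xy).
Qed.

(** The constants are locally bounded, because a good chart at a point is one at
    the neighboring points, and [M] is compact. *)
Theorem uniform_good_charts : exists rho, topology_metric rho /\
  exists2 C, 0 < C & forall x, exists k V, V x /\ good_chart rho C k V.
Proof.
have [s cov] := bump_cover X cM.
have hrho := bump_dist_metric hM cov.
exists (bump_dist s); split => //.
apply: (compact_uniform (P := fun C x => exists k V, V x /\ good_chart (bump_dist s) C k V)).
  move=> C C' x CC [k [V [Vx HV]]]; exists k, V; split => //.
  exact: good_chartW HV.
move=> x; have [c cs c0] := cov x.
have [kx _] := bump_gt0 c0; set k := cb_chart c in kx.
have [r r0 [C1 C10 H1]] := chart_le_bump_dist cs c0.
have [C2 [C20 [V2 nV2 H2]]] := bump_dist_le_chart hM s kx.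
have [C3 C30 H3] := tangent_norm_bounds g kx.
pose V := interior (V2 `&` ([set y | forall v, `|v| <= C3 * tangent_norm g k y v /\
   tangent_norm g k y v <= C3 * `|v|] `&` [set y | bump_dist s x y < r])).
have nV : nbhs x V.
  by apply/nbhs_interior/filterI => //; apply: filterI => //; exact: nbhs_rho.
pose C := C1 + C2 + C3.
exists C; apply: filterS nV => y Vy; exists k, V; split => //; split.
- exact: open_interior.
- by move=> z /interior_subset[_ [_ zr]]; have [] := H1 z z zr zr.
- move=> z v /interior_subset[_ [/(_ v)[h1 h2] _]]; split.
    by apply: (le_trans h1); rewrite ler_wpM2r ?tangent_norm_ge0// lerDr addr_ge0.
  by apply: (le_trans h2); rewrite ler_wpM2r// lerDr addr_ge0.
- move=> z w /interior_subset[V2z [_ zr]] /interior_subset[V2w [_ wr]].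
  have [_ _ h1] := H1 z w zr wr; split.
    by apply: (le_trans h1); rewrite ler_wpM2r ?bump_dist_ge0// /C -addrA lerDl addr_ge0// ltW.
  by apply: (le_trans (H2 z w V2z V2w)); rewrite ler_wpM2r// /C addrAC lerDr addr_ge0// ltW.
Qed.

Section Derivatives.
Variables (rho : M -> M -> R) (C : R).
Hypothesis hrho : topology_metric rho.
Hypothesis C0 : 0 < C.
Hypothesis good : forall x, exists k V, V x /\ good_chart rho C k V.
Variable f : M -> M.
Hypothesis f1 : C1_map X f.

(** Passing to coordinates at the source and at the target costs one factor [C]
    each. *)
Lemma strict_deriv_lipschitz_near (F : M -> M) x k l V W
    (A : {linear 'rV[R]_d -> 'rV[R]_d}) (K e : R) :
  {for x, continuous F} -> V x -> W (F x) -> good_chart rho C k V -> good_chart rho C l W ->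
  strict_deriv (rep F k l) (coord k x) A -> (forall v, `|A v| <= K * `|v|) -> 0 <= K -> 0 < e ->
  lipschitz_near rho F (C * (K + e) * C) x.
Proof.
move=> cF Vx WFx gV gW HA HK K0 e0.
have [s s0 Hs] := strict_deriv_lipschitz e0 HK HA.
have nV : nbhs x V by apply: open_nbhs_nbhs; split => //; exact: gc_open gV.
have nW : nbhs x (F @^-1` W).
  by apply: cF; apply: open_nbhs_nbhs; split => //; exact: gc_open gW.
have /cvgrPdist_lt/(_ _ s0) ns := coord_continuous (gc_dom gV Vx).
have [r r0 Hr] := rho_nbhs hrho (filterI (filterI nV nW) ns).
exists r => // y z /Hr[[Vy Wy] ys] /Hr[[Vz Wz] zs].
rewrite distrC in ys; rewrite distrC in zs.
have [_ h1] := gc_dist gW Wy Wz.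
have h2 := Hs _ _ ys zs.
rewrite /rep /= !coordK in h2; [|exact: (gc_dom gV)|exact: (gc_dom gV)].
have [h3 _] := gc_dist gV Vy Vz.
apply: (le_trans h1); rewrite -!mulrA ler_pM2l//; apply: (le_trans h2).
by rewrite ler_wpM2l// addr_ge0// ltW.
Qed.

Lemma C1_lipschitz : exists L r0 : R,
  [/\ 1 <= L, 0 < r0 & forall x, lipschitz_ball rho f L r0 x].
Proof.
have cf := f1.1.
have [|x|K K0 HK] := @compact_uniform (fun K x => 0 < K /\ lipschitz_ball rho f K K^-1 x).
- move=> K K' x KK [K0 HK]; split; first exact: lt_le_trans KK.
  by apply: (lipschitz_ballW hrho KK _ HK); rewrite lef_pV2 ?posrE// (lt_le_trans K0).
- have [k [V [Vx gV]]] := good x; have [l [W [Wfx gW]]] := good (f x).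
  have HA := strict_deriv_rep f1 (gc_dom gV Vx) (gc_dom gW Wfx).
  have [K K0 HK] := linear_bounded ('d (rep f k l) (coord k x)).
  have [r r0 Hr] := strict_deriv_lipschitz_near (cf x) Vx Wfx gV gW HA HK (ltW K0) ltr01.
  set kap := C * _ * C in Hr.
  have kap0 : 0 < kap by rewrite !mulr_gt0// addr_gt0.
  have r20 : 0 < 2 / r by rewrite divr_gt0.
  exists (kap + 2 / r).
  apply: filterS (lipschitz_near_interior hrho Hr r0) => y Hy.
  have pos : 0 < kap + 2 / r by rewrite addr_gt0.
  split => //; apply: (lipschitz_ballW hrho _ _ Hy); first by rewrite lerDl ltW.
  by rewrite -[r / 2]invrK lef_pV2 ?posrE// invf_div ?lerDr ?invr_gt0 ?divr_gt0// ltW.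
exists (Num.max 1 K), K^-1; split; [by rewrite le_max lexx|by rewrite invr_gt0|].
move=> x; have [_ H] := HK x; apply: (lipschitz_ballW hrho _ _ H) => //.
by rewrite le_max lexx orbT.
Qed.

(** For [n >= N] the operator norm enters through the derivative in good charts at
    [x] and at the [n]-th iterate. The finitely many smaller [n] are covered by the Lipschitz
    constant [L ^ n] and a larger [K]. *)
Lemma opnorm_exp_lipschitz x (l : R) (N : nat) : 0 < l -> l < 1 ->
  (forall n, (N <= n)%N -> opnorm_tangent g (iter n f) x <= l ^+ n) ->
  exists K : R, exp_lipschitz rho f l K x.
Proof.
move=> l0 l1 Hop; have cf := f1.1.
have [L [r0 [L1 r0_gt0 HL]]] := C1_lipschitz.
have L0 : 0 < L := lt_le_trans ltr01 L1.
pose K := C * (C ^+ 2 + 1) * C + L ^+ N / l ^+ N.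
have K1 : 0 <= C * (C ^+ 2 + 1) * C by rewrite !mulr_ge0 ?addr_ge0 ?exprn_ge0 ?(ltW C0).
have K2 : 0 <= L ^+ N / l ^+ N by rewrite divr_ge0 ?exprn_ge0 ?(ltW l0) ?(ltW L0).
exists K => n.
have ln0 : 0 < l ^+ n by rewrite exprn_gt0.
have [nN|Nn] := ltnP n N.
  have [r r_gt0 Hr] := lipschitz_ball_iter hrho n L1 r0_gt0 HL.
  exists r => //; apply: (lipschitz_ballW hrho _ _ (Hr x)) => //.
  apply: (@le_trans _ _ (L ^+ N / l ^+ N * l ^+ n)); last by rewrite ler_wpM2r ?lerDr ?(ltW ln0).
  rewrite mulrAC ler_pdivlMr ?exprn_gt0// ler_pM ?exprn_ge0 ?(ltW l0) ?(ltW L0)//.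
    by rewrite ler_weXn2l// ltnW.
  by rewrite ler_wiXn2l ?(ltW l0) ?(ltW l1)// ltnW.
have [k [V [Vx gV]]] := good x; have [j [W [Wfx gW]]] := good (iter n f x).
have kx := gc_dom gV Vx; have jx := gc_dom gW Wfx.
have [A HA] := strict_deriv_iter f1 kx jx.
have HK v : `|A v| <= C ^+ 2 * l ^+ n * `|v|.
  have [h1 _] := gc_norm gW (A v) Wfx.
  have h2 := strict_deriv_norm g v (continuous_iter cf n x) kx jx HA.
  have [_ h3] := gc_norm gV v Vx.
  have h4 : opnorm_tangent g (iter n f) x * tangent_norm g k x v <= l ^+ n * (C * `|v|).
    apply: (@le_trans _ _ (l ^+ n * tangent_norm g k x v)).
      by rewrite ler_wpM2r ?tangent_norm_ge0 ?Hop.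
    by rewrite ler_wpM2l ?(ltW ln0).
  apply: (le_trans h1); apply: (@le_trans _ _ (C * (l ^+ n * (C * `|v|)))).
    by rewrite ler_wpM2l ?(ltW C0)// (le_trans h2).
  by rewrite expr2 le_eqVlt; apply/orP; left; apply/eqP; ring.
have H := strict_deriv_lipschitz_near (continuous_iter cf n x) Vx Wfx gV gW HA HK
  (mulr_ge0 (exprn_ge0 2 (ltW C0)) (ltW ln0)) ln0.
apply: (lipschitz_nearW hrho _ H).
apply: (@le_trans _ _ (C * (C ^+ 2 + 1) * C * l ^+ n)).
  by rewrite le_eqVlt; apply/orP; left; apply/eqP; ring.
by rewrite ler_wpM2r ?(ltW ln0)// lerDl.
Qed.

(** A negative value of [chi] excludes divergence, whose default value is zero. *)
Lemma chi_neg_opnorm x : (chi g f x < 0)%E ->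
  exists (l : R) (N : nat), [/\ 0 < l, l < 1 &
   forall n, (N <= n)%N -> opnorm_tangent g (iter n f) x <= l ^+ n].
Proof.
rewrite /chi; set u := (fun n => _) => chi0.
have cu : cvgn u.
  apply: contrapT => /dvgP E; move: chi0; rewrite E.
  by rewrite ltxx.
have [c c0 uc] : exists2 c : R, 0 < c & (limn u < (- c)%:E)%E.
  move: chi0; case: (limn u) => [r| |] //= r0.
    rewrite lte_fin in r0; exists (- r / 2); first by rewrite divr_gt0// oppr_gt0.
    by rewrite lte_fin; lra.
  by exists 1 => //; rewrite ltNyr.
have [N _ HN] : \forall n \near \oo, (u n < (- c)%:E)%E.
  have nb : nbhs (limn u) [set y | (y < (- c)%:E)%E].
    by apply: open_nbhs_nbhs; split => //; exact: open_ereal_lt_ereal.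
  exact: (cu _ nb).
exists (expR (- c)), N.+1; split; [exact: expR_gt0|by rewrite expR_lt1; lra|].
move=> n Nn; have n0 : 0 < n%:R :> R by rewrite ltr0n (leq_trans _ Nn).
have : (u n < (- c)%:E)%E := HN n (ltnW Nn); rewrite /u.
set w := opnorm_tangent _ _ _ => un.
have [w0|w0] := leP w 0; first by rewrite (le_trans w0)// exprn_ge0// expR_ge0.
move: un; rewrite lne_EFin// -EFinM lte_fin mulrC ltr_pdivrMr// => h.
by rewrite -(lnK (x := w)) ?posrE// -expRM_natl ler_expR mulrC; exact: ltW.
Qed.

End Derivatives.
End GoodCharts.

(** * Integrals of speeds along paths *)

Section Paths.
Context {R : realType}.

(** The supremum of the times up to which the inequality holds can be passed, by
    the triangle inequality and the local estimate there. *)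
Lemma local_to_global (D : R -> R -> R) (S : R -> R) :
  (forall s t u, D s u <= D s t + D t u) ->
  (forall a, 0 <= a <= 1 -> exists2 e, 0 < e & forall s t, 0 <= s -> s <= t -> t <= 1 ->
     `|s - a| < e -> `|t - a| < e -> D s t <= S t - S s) ->
  D 0 1 <= S 1 - S 0.
Proof.
move=> tri loc; pose A := [set t : R | 0 <= t <= 1 /\ D 0 t <= S t - S 0].
have A0 : A 0.
  split; first by rewrite lexx ler01.
  have [|e e0 H] := loc 0; first by rewrite lexx ler01.
  by apply: H; rewrite ?subrr ?normr0.
have A1 : ubound A 1 by move=> t [/andP[]].
have supA : has_sup A by split; [exists 0|exists 1].
set T := sup A.
have T0 : 0 <= T by apply: ub_le_sup => //; exists 1.
have T1 : T <= 1 by apply: ge_sup => //; exists 0.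
have [|e e0 H] := loc T; first by rewrite T0 T1.
have [s [/andP[s0 s1] As] sT] := sup_adherent e0 supA.
rewrite -/T in sT.
have sT' : s <= T.
  by apply: ub_le_sup; [exists 1|split => //; rewrite s0 s1].
have extend t : T <= t -> t <= 1 -> t < T + e -> A t.
  move=> Tt t1 te; split; first by rewrite (le_trans T0 Tt).
  have := tri 0 s t.
  have : D s t <= S t - S s.
    apply: H => //; first exact: le_trans Tt.
      by rewrite distrC ger0_norm ?subr_ge0//; lra.
    by rewrite ger0_norm ?subr_ge0//; lra.
  lra.
have [T_lt1|T_ge1] := ltP T 1; last first.
  by have [] := extend 1 T1 (lexx 1) ltac:(lra).
have At : A (Num.min 1 (T + e / 2)).
  apply: extend; rewrite ?le_min ?T1 ?ge_min ?lexx//; first by lra.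
  by rewrite gt_min; apply/orP; right; lra.
have := ub_le_sup (ex_intro _ 1 A1) At.
by rewrite -/T ge_min => /orP[]; lra.
Qed.

Variables (v : R -> R).
Hypothesis cv : forall t : R, 0 <= t <= 1 -> {for t, continuous v}.

Definition primitive (t : R) : R := \int[lebesgue_measure]_(x in `[0, t]) v x.

Lemma integrable_on_unit :
  (@lebesgue_measure R).-integrable `[0, 1] (EFin \o v).
Proof.
apply: continuous_compact_integrable; first exact: segment_compact.
apply: continuous_in_subspaceT => t; rewrite inE /= in_itv/= => t01.
exact: cv.
Qed.

Lemma primitive_continuous : {within `[0, 1], continuous primitive}.
Proof. exact: (parameterized_integral_continuous ler01 integrable_on_unit). Qed.

Lemma primitive_derive (t : R) : 0 < t -> t < 1 -> is_derive t 1 primitive (v t).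
Proof.
move=> t0 t1.
have [dS ES] := continuous_FTC1_closed t1 integrable_on_unit t0 (cv (t := t) ltac:(by rewrite !ltW)).
apply: DeriveDef; first exact: dS.
by rewrite -derive1E; exact: ES.
Qed.

(** Every coordinate of [c], with either sign, plus [K] times the primitive of
    [v] has a nonnegative derivative. *)
Lemma path_displacement {d} (c : R -> 'rV[R]_d) (K s t : R) : 0 <= K ->
  0 <= s -> s <= t -> t <= 1 ->
  (forall u, s <= u <= t -> differentiable c u /\ `|'d c u 1| <= K * v u) ->
  `|c t - c s| <= K * (primitive t - primitive s).
Proof.
move=> K0 s0 st t1 Hc.
have main (w dw : R -> R) : (forall u, s <= u <= t -> is_derive u 1 w (dw u)) ->
    (forall u, s <= u <= t -> `|dw u| <= K * v u) ->
    K * primitive s + w s <= K * primitive t + w t.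
  move=> Hw Hdw; pose h u := K * primitive u + w u.
  have dh (u : R) : u \in `]s, t[%R -> is_derive u 1 h (K * v u + dw u).
    rewrite in_itv/= => /andP[su ut].
    have D1 := primitive_derive (le_lt_trans s0 su) (lt_le_trans ut t1).
    have D2 := Hw u ltac:(by rewrite !ltW).
    exact: (is_deriveD (is_deriveZ K D1) D2).
  apply: (@ger0_derive1_le_cc R h s t); last exact: st.
  - by move=> u ust; have [] := dh u ust.
  - move=> u ust; rewrite derive1E (derive_val (is_derive := dh u ust)).
    move: ust; rewrite in_itv/= => /andP[su ut].
    have := Hdw u ltac:(by rewrite !ltW).
    by rewrite ler_norml => /andP[+ _]; lra.
  - have sub : `[s, t] `<=` `[0, 1].
      by move=> u /=; rewrite !in_itv/= => /andP[su ut]; rewrite (le_trans s0 su) (le_trans ut t1).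
    have cS := continuous_subspaceW sub primitive_continuous.
    have cw : {within `[s, t], continuous w}.
      by apply: derivable_within_continuous => u; rewrite in_itv/= => /Hw[].
    by move=> u; apply: cvgD; [apply: cvgMr; exact: cS|exact: cw].
  - by rewrite in_itv/= lexx st.
  - by rewrite in_itv/= st lexx.
apply: norm_le_entries => [|i l].
  have h0 u : s <= u <= t -> `|0 : R| <= K * v u.
    by move=> ust; rewrite normr0 (le_trans (normr_ge0 _) (Hc u ust).2).
  have := main (cst 0) (fun=> 0) (fun u _ => is_derive_cst _ _ _) h0.
  by rewrite /cst !addr0 mulrBr subr_ge0.
have dl u : s <= u <= t -> is_derive u 1 (fun x => c x 0 l) ('d c u 1 0 l).
  by move=> ust; exact: is_derive_entry (Hc u ust).1.
have bl u : s <= u <= t -> `|'d c u 1 0 l| <= K * v u.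
  by move=> ust; apply: (le_trans (entry_le_norm _ _ _)); exact: (Hc u ust).2.
rewrite !ord1 !mxE ler_norml mulrBr.
have h1 := main _ _ dl bl.
have h2 := main (fun x => - c x 0 l) (fun u => - 'd c u 1 0 l)
  (fun u ust => is_deriveN (dl u ust)) ltac:(by move=> u ust; rewrite normrN; exact: bl).
by apply/andP; split; lra.
Qed.

End Paths.

(** * Riemannian distance and sinks *)

Section Arcs.
Context {R : realType} {d : nat} {M : ptopologicalType}.
Variables (X : smooth_manifold R d M) (g : riemannian_metric X).

(** The tangent norm of the velocity is the same in all charts. *)
Lemma speed_chart (gamma : R -> M) (t : R) (k : chart X) :
  {for t, continuous gamma} -> dom k (gamma t) ->
  (forall i : chart X, dom i (gamma t) -> differentiable (coord i \o gamma) t) ->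
  speed g gamma t = tangent_norm g k (gamma t) ('d (coord k \o gamma) t 1).
Proof.
move=> ct kt dg; rewrite /speed derive1E.
set j := chart_at X (gamma t).
have jt : dom j (gamma t) := dom_chart_at X _.
have dj := dg j jt; have dk := dg k kt.
have dtr : differentiable (coord k \o param j) ((coord j \o gamma) t).
  by apply: (transition_smooth j k 1).1; exists (gamma t).
have E : 'd (coord k \o gamma) t 1 = 'd (coord k \o param j) (coord j (gamma t)) ('D_1 (coord j \o gamma) t).
  rewrite -deriveE// (near_eq_derive (g := (coord k \o param j) \o (coord j \o gamma))).
    rewrite deriveE; last exact: differentiable_comp dj dtr.
    have -> := deriveE (1 : R) dj.
    exact: (congr1 (fun h : R -> 'rV[R]_d => h 1) (diff_comp dj dtr)).
  have nj : nbhs t (gamma @^-1` dom j) := ct _ (nbhs_dom jt).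
  by apply: filterS nj => s js; rewrite /= coordK.
rewrite E; apply/esym.
exact: tangent_norm_transition.
Qed.

Lemma C1_arc_near (gamma : R -> M) (t : R) (k : chart X) : C1_arc X gamma ->
  0 <= t <= 1 -> dom k (gamma t) ->
  \forall s \near t, [/\ {for s, continuous gamma}, dom k (gamma s),
    (forall i : chart X, dom i (gamma s) -> differentiable (coord i \o gamma) s) &
    forall v, {for s, continuous (fun u => 'd (coord k \o gamma) u v)}].
Proof.
move=> [U [oU sub cg C1]] t01 kt.
have Ut : U t by apply: sub; rewrite /= in_itv.
have nU : nbhs t U by apply: open_nbhs_nbhs.
have nk := cg t Ut _ (nbhs_dom kt).
apply: filterS (filterI nU nk) => s [Us ks]; split => //; first exact: cg.
  by move=> i si; apply: (C1 i).1.
by move=> v; apply: (C1 k).2.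
Qed.

Lemma speed_continuous (gamma : R -> M) (t : R) : C1_arc X gamma ->
  0 <= t <= 1 -> {for t, continuous (speed g gamma)}.
Proof.
move=> arc t01; set k := chart_at X (gamma t).
have kt : dom k (gamma t) := dom_chart_at X _.
have near_t := C1_arc_near arc t01 kt.
have [ct _ dt cd] := nbhs_singleton near_t.
have E : \forall s \near t, tangent_norm g k (gamma s) ('d (coord k \o gamma) s 1) = speed g gamma s.
  by apply: filterS near_t => s [cs ks ds _]; rewrite (speed_chart cs ks ds).
rewrite /prop_for /continuous_at (speed_chart ct kt dt).
apply: cvg_trans (near_eq_cvg E) _.
rewrite /tangent_norm.
have := @sqrt_continuous R ((('d (coord k \o gamma) t 1) *m metric g k (coord k (gamma t)) *m ('d (coord k \o gamma) t 1)^T) 0 0).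
apply: cvg_comp.
apply: quadratic_cvg; last exact: cd.
have c1 : coord k (gamma s) @[s --> t] --> coord k (gamma t).
  apply: (@continuous_comp _ _ _ gamma (coord k) t ct).
  exact: coord_continuous.
apply: (cvg_comp _ _ c1).
by apply: (@metric_smooth _ _ _ _ g k 0%N); exists (gamma t).
Qed.

Section Distances.
Variables (rho : M -> M -> R) (C : R).
Hypothesis hrho : topology_metric rho.
Hypothesis C0 : 0 < C.
Hypothesis good : forall x, exists k V, V x /\ good_chart g rho C k V.

(** Within a good chart the displacement is bounded by the integral of the speed;
    these local estimates add up along the arc. *)
Lemma arc_dist (gamma : R -> M) : C1_arc X gamma ->
  rho (gamma 0) (gamma 1) <= C * C * arc_length g gamma.
Proof.
move=> arc.
have cs (t : R) : 0 <= t <= 1 -> {for t, continuous (speed g gamma)}.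
  by move=> t01; exact: speed_continuous.
pose S t := C * C * primitive (speed g gamma) t.
have E0 : primitive (speed g gamma) 0 = 0.
  by rewrite /primitive set_itv1 Rintegral_set1.
have -> : C * C * arc_length g gamma = S 1 - S 0.
  by rewrite /S E0 mulr0 subr0.
apply: (@local_to_global _ (fun s t => rho (gamma s) (gamma t)) S).
  by move=> s t u; exact: rho_triangle.
move=> a a01; have [k [V [Va gV]]] := good (gamma a).
have near_a := C1_arc_near arc a01 (gc_dom gV Va).
have [ca _ _ _] := nbhs_singleton near_a.
have nV : \forall s \near a, V (gamma s).
  by apply: ca; apply: open_nbhs_nbhs; split => //; exact: gc_open gV.
have : \forall s \near a, V (gamma s) /\ [/\ {for s, continuous gamma}, dom k (gamma s),
    (forall i : chart X, dom i (gamma s) -> differentiable (coord i \o gamma) s) &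
    forall v, {for s, continuous (fun u => 'd (coord k \o gamma) u v)}].
  exact: filterI.
move=> /nbhs_normP[e /= e0 He]; exists e => // s t s0 st t1 sa ta.
have inb u : s <= u <= t -> `|a - u| < e.
  move=> /andP[su ut]; move: sa ta; rewrite !ltr_norml => /andP[h1 h2] /andP[h3 h4].
  by apply/andP; split; lra.
have [_ h2] := gc_dist gV (He s (inb s ltac:(by rewrite lexx st))).1 (He t (inb t ltac:(by rewrite st lexx))).1.
apply: (le_trans h2).
have -> : S t - S s = C * (C * (primitive (speed g gamma) t - primitive (speed g gamma) s)).
  by rewrite /S; ring.
rewrite ler_pM2l// distrC.
apply: (path_displacement cs (c := coord k \o gamma) (ltW C0) s0 st t1).
move=> u sut; have [Vu [cu ku du _]] := He u (inb u sut).
split; first exact: du.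
by rewrite (speed_chart cu ku du); have [] := gc_norm gV ('d (coord k \o gamma) u 1) Vu.
Qed.

Lemma joined_dist x y l : joined g x y l -> rho x y <= C * C * l.
Proof.
elim=> [z|gamma z l' arc _ IH]; first by rewrite (rhoxx hrho) mulr0.
by rewrite mulrDr (le_trans (rho_triangle hrho _ (gamma 1) _))// lerD// arc_dist.
Qed.

Lemma continuous_near_eq {U V : topologicalType} (h1 h2 : U -> V) (t : U) :
  (\forall s \near t, h1 s = h2 s) -> {for t, continuous h1} -> {for t, continuous h2}.
Proof.
move=> E c1; rewrite /prop_for/= /continuous_at -(nbhs_singleton E).
exact: cvg_trans (near_eq_cvg E) c1.
Qed.

Lemma line_derive (u w : 'rV[R]_d) (t : R) :
  differentiable (fun s : R => u + s *: w) t /\ 'D_1 (fun s : R => u + s *: w) t = w.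
Proof.
have did : differentiable (@idfun 'rV[R]_d) (u + t *: w) by exact: ex_diff.
have [dl E] := differentiable_line did.
split; first exact: dl.
rewrite deriveE; last exact: dl.
by rewrite [LHS]E diff_val.
Qed.

(** The straight segment in the chart, whose velocity is constant in
    coordinates. *)
Lemma segment_arc x k V : V x -> good_chart g rho C k V ->
  exists2 W, nbhs x W & forall y z, W y -> W z -> exists gamma,
    [/\ C1_arc X gamma, gamma 0 = y, gamma 1 = z &
        arc_length g gamma <= C * `|coord k y - coord k z|].
Proof.
move=> Vx gV; have kx := gc_dom gV Vx; set a := coord k x.
have nV : nbhs x V by apply: open_nbhs_nbhs; split => //; exact: gc_open gV.
have /nbhs_normP[e /= e0 He] := param_nbhs kx nV; rewrite -/a in He.
exists [set y | dom k y /\ `|coord k y - a| < e].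
  have /cvgrPdist_lt/(_ _ e0) n1 := coord_continuous kx.
  apply: filterS (filterI (nbhs_dom kx) n1) => y [ky ye].
  by split => //; rewrite distrC.
move=> y z [ky ye] [kz ze].
set u := coord k y in ye *; set v := coord k z in ze *.
(* The arc is defined on the open set [B] of the times at which the line stays in
   the ball. *)
pose w := v - u; pose line (t : R) := u + t *: w; pose gamma t := param k (line t).
pose B := [set t : R | `|line t - a| < e].
have cl : continuous line.
  by move=> t; apply: differentiable_continuous; have [] := line_derive u w t.
have oB : open B.
  apply: (@open_comp _ _ (fun t => `|line t - a|) [set s | s < e]); last exact: open_lt.
  by move=> t _; apply: cvg_norm; apply: cvgB; [exact: cl|exact: cvg_cst].
have nB t : B t -> nbhs t B by move=> Bt; apply: open_nbhs_nbhs.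
have unitB : `[0, 1] `<=` B.
  move=> t; rewrite /= in_itv/= => /andP[t0 t1]; rewrite /B/=.
  have -> : line t - a = (1 - t) *: (u - a) + t *: (v - a).
    by apply/matrixP => i j; rewrite !mxE; ring.
  apply: (le_lt_trans (ler_normD _ _)); rewrite !normrZ !ger0_norm ?subr_ge0//.
  have [->|tn0] := eqVneq t 0; first by rewrite subr0 mul1r mul0r addr0.
  have t00 : 0 < t by rewrite lt_neqAle eq_sym tn0.
  have h1 : (1 - t) * `|u - a| <= (1 - t) * e by rewrite ler_wpM2l ?subr_ge0// ltW.
  have h2 : t * `|v - a| < t * e by rewrite ltr_pM2l.
  by apply: (lt_le_trans (ler_ltD h1 h2)); rewrite -mulrDl subrK mul1r.
have inV t : B t -> V (gamma t) /\ (coord k @` dom k) (line t).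
  by move=> Bt; apply: He; rewrite /= distrC.
have cK t : B t -> dom k (gamma t) /\ coord k (gamma t) = line t.
  by move=> /inV[_ /paramK].
have cg t : B t -> {for t, continuous gamma}.
  move=> /inV[_ lt]; apply: (@continuous_comp _ _ _ line (param k) t); first exact: cl.
  exact: param_continuous.
have dtr (i : chart X) t : B t -> dom i (gamma t) -> (coord k @` (dom k `&` dom i)) (line t).
  by move=> /cK[kt E] it; exists (gamma t).
have dg (i : chart X) t : B t -> dom i (gamma t) -> differentiable (coord i \o gamma) t /\
    'd (coord i \o gamma) t 1 = 'd (coord i \o param k) (line t) w.
  move=> Bt it; apply: (@differentiable_line _ _ _ (coord i \o param k)).
  by apply: (transition_smooth k i 1).1; exact: dtr.
have arc : C1_arc X gamma.
  exists B; split => // i; split; first by move=> t [Bt it]; have [] := dg i t Bt it.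
  move=> r t [Bt it] /=.
  have nBi : nbhs t (B `&` gamma @^-1` dom i).
    by apply: filterI; [exact: nB|exact: (cg t Bt _ (nbhs_dom it))].
  have E s : (B `&` gamma @^-1` dom i) s ->
      r *: 'd (coord i \o param k) (line s) w = 'd (coord i \o gamma) s r.
    move=> [Bs is']; have [_ <-] := dg i s Bs is'.
    by rewrite -linearZ /= [r%:A]mulr1.
  have Enear : \forall s \near t, r *: 'd (coord i \o param k) (line s) w = 'd (coord i \o gamma) s r.
    by apply: filterS nBi => s; exact: E.
  apply: (continuous_near_eq Enear).
  apply: cvgZr.
  apply: (@cvg_comp _ _ _ line (fun q => 'd (coord i \o param k) q w) _ (nbhs (line t))).
    exact: cl.
  by apply: (transition_smooth k i 1).2; exact: dtr.
have g0 : gamma 0 = y by rewrite /gamma /line scale0r addr0 coordK.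
have g1 : gamma 1 = z by rewrite /gamma /line scale1r addrC subrK coordK.
exists gamma; split => //.
have speed_le t : 0 <= t <= 1 -> speed g gamma t <= C * `|u - v|.
  move=> t01; have Bt : B t by apply: unitB; rewrite /= in_itv.
  have [kt _] := cK t Bt; have [Vt _] := inV t Bt.
  rewrite (speed_chart (cg t Bt) kt); last by move=> i it; have [] := dg i t Bt it.
  have -> : 'd (coord k \o gamma) t 1 = w.
    have [dk _] := dg k t Bt kt.
    have [_ lw] := line_derive u w t.
    rewrite -(deriveE (1 : R) dk) -[RHS]lw; apply: near_eq_derive.
    by apply: filterS (nB t Bt) => s /cK[].
  by rewrite distrC; have [] := gc_norm gV w Vt.
have cs (t : R) : 0 <= t <= 1 -> {for t, continuous (speed g gamma)}.
  by move=> t01; exact: speed_continuous.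
have icst : (@lebesgue_measure R).-integrable `[0, 1] (EFin \o cst (C * `|u - v|)).
  by apply: integrable_on_unit => t _; exact: cvg_cst.
apply: (@le_trans _ _ (\int[lebesgue_measure]_(t in `[0, 1]) (C * `|u - v|))).
  have H t : `[0, 1]%classic t -> speed g gamma t <= cst (C * `|u - v|) t.
    by rewrite /= in_itv/=; exact: speed_le.
  by apply: (le_Rintegral _ (integrable_on_unit cs) icst H).
rewrite Rintegral_cst//= lebesgue_measure_itv/= lte01 sube0.
by rewrite mulr1.
Qed.

(** The segment bounds the infimum from above and shows that it is over a nonempty
    set; [joined_dist] bounds it from below. *)
Lemma riemannian_dist_local (x : M) : exists2 W, nbhs x W & forall y z, W y -> W z ->
  riemannian_dist g y z <= C * C * rho y z /\ rho y z <= C * C * riemannian_dist g y z.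
Proof.
have [k [V [Vx gV]]] := good x.
have [W nW HW] := segment_arc Vx gV.
have nV : nbhs x V by apply: open_nbhs_nbhs; split => //; exact: gc_open gV.
have CC : 0 < C * C by rewrite mulr_gt0.
exists (V `&` W); first exact: filterI.
move=> y z [Vy Wy] [Vz Wz].
have [gamma [arc g0 g1 len]] := HW y z Wy Wz.
have jn : joined g y z (arc_length g gamma).
  rewrite -g0 -[arc_length _ _]addr0; apply: joined_step arc _.
  by rewrite g1; exact: joined_refl.
have lb : lbound [set l | joined g y z l] (rho y z / (C * C)).
  by move=> l /joined_dist; rewrite ler_pdivrMr// mulrC.
split.
  apply: (@le_trans _ _ (arc_length g gamma)).
    by apply: ge_inf => //; exists (rho y z / (C * C)).
  apply: (le_trans len); rewrite -mulrA ler_pM2l//.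
  by have [] := gc_dist gV Vy Vz.
rewrite mulrC -ler_pdivrMr//; apply: lb_le_inf => //.
by exists (arc_length g gamma).
Qed.

(** A multiple [tau] of the period contracts [rho] by [kap]. The two comparisons of
    [rho] with the Riemannian distance cost the factor [D], and [kap * D] is at
    most one quarter. *)
Theorem contracting_periodic_sink (f : M -> M) (p : M) (n : nat) (l K : R) :
  (0 < n)%N -> iter n f p = p -> 0 < l -> l < 1 -> exp_lipschitz rho f l K p ->
  sink g f p.
Proof.
move=> n0 np l0 l1 HK.
have [W nW HW] := riemannian_dist_local p.
have [r2 r20 HW2] := rho_nbhs hrho nW.
pose D := C * C * (C * C).
have CC : 0 < C * C by rewrite mulr_gt0.
have D0 : 0 < D by rewrite mulr_gt0.
pose kap := Num.min 2^-1 ((4 * D)^-1).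
have D4 : 0 < 4 * D by rewrite mulr_gt0.
have kap0 : 0 < kap by rewrite lt_min !invr_gt0 D4 ltr0n.
have [N0 HN0] := @geometric_small _ l K kap (ltW l0) l1 kap0.
pose tau := (N0.+1 * n)%N.
have tp : iter tau f p = p by rewrite iter_period.
have [r r0 Hr] := HK tau.
have lip : lipschitz_ball rho (iter tau f) kap (Num.min r r2) p.
  apply: (lipschitz_ballW hrho _ _ Hr); last by rewrite ge_min lexx.
  by apply: HN0; rewrite /tau; nia.
pose V := [set q | rho p q < Num.min r r2].
have nV : nbhs p V by apply: nbhs_rho => //; rewrite lt_min r0.
have kap1 : kap <= 2^-1 by rewrite ge_min lexx.
have VV q : V q -> V (iter tau f q).
  move=> Vq; rewrite /V/= -[X in rho X _]tp.
  have pp : rho p p < Num.min r r2 by rewrite (rhoxx hrho) lt_min r0.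
  apply: (le_lt_trans (lip _ _ pp Vq)); apply: le_lt_trans Vq.
  by rewrite ler_piMl ?(rho_ge0 hrho)//; lra.
have VW q : V q -> W q by move=> Vq; apply: HW2; move: Vq; rewrite /V/= lt_min => /andP[].
exists tau; first by rewrite /tau muln_gt0.
exists V => //; exists 2^-1; first by rewrite invr_gt0 invf_lt1 ?ltr1n ?ltr0n.
move=> q q' Vq Vq' qq'.
have [h1 _] := HW _ _ (VW _ (VV _ Vq)) (VW _ (VV _ Vq')).
have [_ h2] := HW _ _ (VW _ Vq) (VW _ Vq').
have h3 := lip _ _ Vq Vq'.
have pos : 0 < rho q q'.
  rewrite lt_neqAle (rho_ge0 hrho) andbT eq_sym; apply/eqP => E.
  exact/qq'/(rho_sep hrho).
set dqq := riemannian_dist g q q' in h2 *.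
have dpos : 0 < dqq by rewrite -(pmulr_rgt0 _ CC); exact: lt_le_trans pos h2.
have kD : kap * D <= 4^-1.
  have : kap <= (4 * D)^-1 by rewrite ge_min lexx orbT.
  by move=> h; rewrite -ler_pdivlMr// -invfM.
have h4 : riemannian_dist g (iter tau f q) (iter tau f q') <= kap * D * dqq.
  apply: (le_trans h1).
  have -> : kap * D * dqq = C * C * (kap * (C * C * dqq)) by rewrite /D; ring.
  by rewrite ler_pM2l// (le_trans h3)// ler_pM2l.
apply: (le_lt_trans h4); apply: (@le_lt_trans _ _ (4^-1 * dqq)).
  by rewrite ler_pM2r.
by rewrite ltr_pM2r//; lra.
Qed.

End Distances.
End Arcs.

(** * The decomposition *)

Section Carrier.
Context {R : realType} {d : nat} {M : ptopologicalType}.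
Variables (X : smooth_manifold R d M) (g : riemannian_metric X).
Hypothesis hM : hausdorff_space M.
Hypothesis cM : compact [set: M].
Variables (f : M -> M) (mu : probability (borel M) R).
Hypothesis f1 : C1_map X f.
Hypothesis mu_f : invariant_measure f mu.
Hypothesis chi_neg : {ae mu, forall x, (chi g f x < 0)%E}.

(** Almost every point has a rate [l < 1], and the rates [1 - 1 / (k + 2)] reduce
    the matter to countably many values of [l]. *)
Lemma sinks_carry_measure : exists S : set M,
  [/\ countable S, forall x, S x -> exists2 n, (0 < n)%N & iter n f x = x,
      forall x, S x -> sink g f x & mu.-negligible (~` S : set (borel M))].
Proof.
have cf := f1.1.
have [rho [hrho [C C0 good]]] := uniform_good_charts g hM cM.
have [L [r0 [L1 r00 fL]]] := C1_lipschitz cM hrho C0 good f1.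
pose exp_stable x := exists l K : R, [/\ 0 < l, l < 1 & exp_lipschitz rho f l K x].
exists [set x | periodic f x /\ exp_stable x]; split.
- exact: (countable_stable_periodic hrho f cM).
- by move=> x [].
- move=> x [[n n0 nx] [l [K [l0 l1 HK]]]].
  exact: (contracting_periodic_sink hrho C0 good n0 nx l0 l1 HK).
pose lam k : R := 1 - k.+2%:R^-1.
have lam0 k : 0 < lam k by rewrite subr_gt0 invf_lt1 ?ltr1n.
have lam1 k : lam k < 1 by rewrite ltrBlDr ltrDl invr_gt0.
pose B k := [set x | exists N : nat, exp_lipschitz rho f (lam k) N%:R x].
have neglB : mu.-negligible (\bigcup_k (B k `\` periodic f)).
  apply: negligible_bigcup => k.
  exact: (negligible_not_periodic hrho cM cf mu_f L1 r00 fL (lam0 k) (lam1 k)).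
apply: negligibleS (negligibleU chi_neg neglB) => x /= nS.
have [chi0|nchi] := pselect ((chi g f x < 0)%E); last by left.
right.
have [l [N [l0 l1 Hop]]] := chi_neg_opnorm chi0.
have [K HK] := opnorm_exp_lipschitz cM hrho C0 good f1 l0 l1 Hop.
have e0 : 0 < 1 - l by rewrite subr_gt0.
have [k _ Hk] := near_infty_natSinv_lt (PosNum e0).
exists k => //; split; last by move=> px; apply: nS; split => //; exists l, K.
exists (Num.truncn K).+1.
apply: (exp_lipschitzW hrho _ _ _ _ HK) => //; [exact: ltW| |exact: ltW (truncnS_gt K)].
by have := Hk k.+1 (leqnSn k); rewrite /= /lam; move: (_^-1) => w; lra.
Qed.

End Carrier.

Theorem corollary1p2 (R : realType) (d : nat) (hd : (2 <= d)%N)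
    (M : ptopologicalType) (X : smooth_manifold R d M)
    (g : riemannian_metric X)
    (M_hausdorff : hausdorff_space M)
    (M_connected : connected [set: M]) (M_compact : compact [set: M])
    (f : M -> M) (f_C1 : C1_map X f)
    (mu : probability (borel M) R) (mu_inv : invariant_measure f mu)
    (Df_inf : 0 < inf (range (opnorm_tangent g f)))
    (chi_neg : {ae mu, forall x, (chi g f x < 0)%E}) :
  (exists (mut : {measure set (borel M) -> \bar R})
      (I : set nat) (p : nat -> M)
      (mus : nat -> {measure set (borel M) -> \bar R}),
    [/\ (forall i, I i -> sink g f (p i) /\
                          multiple_of_orbit_dirac f (p i) (mus i)),
        set_inj I (fun i => orbit_set f (p i)),
        (forall A : set (borel M), measurable A ->
           mu A = (mut A + \esum_(i in I) mus i A)%E) &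
        {ae mut, forall x, (0 <= A1_minus g f x)%E}]) /\
  (ergodic_measure f mu ->
   exists2 p : M, sink g f p & mu (orbit_set f p : set (borel M)) = 1%E).
Proof.
have [S [cS perS sinkS nS]] := sinks_carry_measure M_hausdorff M_compact f_C1 mu_inv chi_neg.
have m1 (x : M) : measurable ([set x] : set (borel M)).
  by apply: closed_borel; exact/accessible_closed_set1/hausdorff_accessible.
split.
  have [I [p [mus [Hp pinj sum]]]] := orbit_decomposition f_C1.1 mu_inv m1 cS perS nS.
  exists mzero, I, p, mus; split => //.
  - by move=> i /Hp[/sinkS ? _ ?].
  - by move=> A mA; rewrite /mzero add0e sum.
  - by exists setT; split.
move=> erg.
have [p Sp mp] := ergodic_orbit f_C1.1 mu_inv m1 cS perS nS erg.
by exists p => //; exact: sinkS.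
Qed.
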